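(* Let $C_\omega\subset\mathring{\Delta}_{n,2}$ be a chamber with $\dim C_\omega=n-1$. Let $\mathcal{A}=(1,\ldots,1)$ and let $\mathcal{B}\in D_\omega\subset\mathcal{D}_{0,n}$, where $D_\omega$ is the chamber of $\mathcal{D}_{0,n}$ such that $C_\omega\subset\overline{D}_\omega$. Then, under the identifications $\mathcal{F}_n\cong\overline{\mathcal{M}}_{0,n}=\overline{\mathcal{M}}_{0,\mathcal{A}}$ and $F_\omega\cong\overline{\mathcal{M}}_{0,\mathcal{B}}$, the projection map $p_\omega:\mathcal{F}_n\to F_\omega$ coincides with the reduction morphism $\rho_{\mathcal{A},\mathcal{B}}:\overline{\mathcal{M}}_{0,\mathcal{A}}\to\overline{\mathcal{M}}_{0,\mathcal{B}}$.
   Context: Hassett spaces: weight data (genus $0$) is a vector $\mathcal{A}=(a_1,\ldots,a_n)\in\mathbb{Q}^n$ with $0<a_i\le 1$ and $a_1+\cdots+a_n>2$. An $\mathcal{A}$-stable genus $0$ curve is a connected nodal curve $C$ of arithmetic genus $0$ with marked points $s_1,\ldots,s_n$ in its smooth locus such that $K_C+\sum a_is_i$ is ample and $\sum_{i\in I}a_i\le 1$ whenever the points $s_i$, $i\in I$, coincide. $\overline{\mathcal{M}}_{0,\mathcal{A}}$ is the moduli space of such curves. If $b_i\le a_i$ for all $i$, the (birational) reduction morphism $\rho_{\mathcal{A},\mathcal{B}}:\overline{\mathcal{M}}_{0,\mathcal{A}}\to\overline{\mathcal{M}}_{0,\mathcal{B}}$ successively collapses the components along which $K_C+\sum b_is_i$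 fails to be ample. $\mathcal{D}_{0,n}=\{(a_1,\ldots,a_n)\in\mathbb{R}^n : 0<a_i\le 1,\ a_1+\cdots+a_n>2\}$, with the (fine) chamber decomposition defined by the hyperplanes $\sum_{j\in S}a_j=1$, $S\subset\{1,\ldots,n\}$, $2\le|S|\le n-2$; for $\dim C_\omega=n-1$ there is a unique such chamber $D_\omega$ with $C_\omega\subset\overline{D}_\omega$. Grassmannian side: $G_{n,2}$ is the Grassmannian of $2$-dimensional subspaces of $\mathbb{C}^n$ with Plücker coordinates $P^I$, $I\subset\{1,\ldots,n\}$, $|I|=2$, and the canonical actions of $(\mathbb{C}^* )^n$ and of the compact torus $T^n$. The moment map is $\mu(L)=\frac{1}{\sum_I|P^I(L)|^2}\sum_I|P^I(L)|^2\Lambda_I$, where $\Lambda_I\in\mathbb{Z}^n$ is the indicator vector of $I$; its image is the hypersimplex $\Delta_{n,2}=\{x\in[0,1]^n : \sum x_i=2\}$, with relative interior $\mathring{\Delta}_{n,2}$. It induces $\hat\mu:G_{n,2}/T^n\to\Delta_{n,2}$. For a set $\sigma$ of two-element subsets of $\{1,\ldots,n\}$, the stratum is $W_\sigma=\{L : P^I(L)\ne 0\iff I\in\sigma\}$; when it is non-empty, $P_\sigma=\mathrm{conv}(\Lambda_I, I\in\sigma)$ is an admissible polytope, $\mu(W_\sigma)=\mathring{P}_\sigma$ (relative interior), and $F_\sigma=W_\sigma/(\mathbb{C}^* )^n$. For a set $\omega$ of such $\sigma$, the chamber $C_\omega$ is $C_\omega=\bigcap_{\sigma\in\omega}\mathring{P}_\sigma$,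 required to be non-empty and such that $C_\omega\cap\mathring{P}_\sigma=\emptyset$ for $\sigma\notin\omega$. The space of parameters is $F_\omega=\bigcup_{\sigma\in\omega}F_\sigma$, homeomorphic to $\hat\mu^{-1}(x)$ for every $x\in C_\omega$; as a variety it is the categorical quotient of $\bigcup_{\sigma\in\omega}W_\sigma$ by $(\mathbb{C}^* )^n$, identified with the GIT quotient of $(\mathbb{C}P^1)^n$ by the diagonal action of $PGL_2(\mathbb{C})$ with fractional linearisation in $C_\omega$. For $\dim C_\omega=n-1$ and $\mathcal{B}\in D_\omega$ it is naturally isomorphic to $\overline{\mathcal{M}}_{0,\mathcal{B}}$. The main stratum is $W_n=\{L : P^I(L)\ne0 \text{ for all } I\}$ and $F_n=W_n/(\mathbb{C}^* )^n\cong\mathcal{M}_{0,n}$; it is contained as a dense subset in every $F_\omega$ with $C_\omega\subset\mathring{\Delta}_{n,2}$. The universal space of parameters $\mathcal{F}_n$ is a smooth compact manifold which is a compactification of $F_n$, identified with $\overline{\mathcal{M}}_{0,n}$. The projection $p_\omega:\mathcal{F}_n\to F_\omega$ is the continuous map which is the identity on $F_n$ (and hence is determined by this property). *)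

(* Defs.v *)
From HB Require Import structures.
From mathcomp Require Import all_boot all_order all_algebra.
From mathcomp Require Import all_classical all_reals all_analysis.
From mathcomp Require Import generic_quotient.
From mathcomp Require Export complex.

Set Implicit Arguments.
Unset Strict Implicit.
Unset Printing Implicit Defensive.

Import Order.TTheory GRing.Theory Num.Theory.
Import numFieldNormedType.Exports.
Local Open Scope ring_scope.

(* A point of the projective line over K is the line spanned by a nonzero row
   vector; PGL_2 acts by right multiplication. *)
Definition same_point (K : fieldType) (p q : 'rV[K]_2) : bool := (p == q)%MS.

Definition det2 (K : fieldType) (p q : 'rV[K]_2) : K := \det (col_mx p q).

(* Every component of a connected nodal curve of arithmetic genus 0 is a
   projective line, and two components meet in at most one node.  Hence such a
   curve is given by the components, indexed by 'I_(ncomp C), the adjacency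
   relation of components, and, for adjacent u and v, the position node C u v
   on the component u of the node joining u to v.  The value of node at
   non-adjacent pairs is irrelevant. *)
Record curve (K : fieldType) (n : nat) := Curve {
  ncomp : nat;
  adj : 'I_ncomp -> 'I_ncomp -> bool;
  node : 'I_ncomp -> 'I_ncomp -> 'rV[K]_2;
  cpt : 'I_n -> 'I_ncomp;
  mark : 'I_n -> 'rV[K]_2 }.

Arguments adj {K n} c _ _.
Arguments node {K n} c _ _.

HB.instance Definition _ (K : fieldType) n := gen_eqMixin (curve K n).
HB.instance Definition _ (K : fieldType) n := gen_choiceMixin (curve K n).

Section Curves.
Variables (K : fieldType) (n : nat).
Implicit Types C D : curve K n.

(* Since all components are rational, the arithmetic genus of a connected curve
   is 1 - #components + #nodes. *)
Definition genus0_nodal C : Prop :=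
  [/\ (forall u v, adj C u v = adj C v u) /\ (forall u, ~~ adj C u u),
      (0 < ncomp C)%N /\ (forall u v, connect (adj C) u v),
      #|[set e : 'I_(ncomp C) * 'I_(ncomp C) | adj C e.1 e.2]%SET|
        = (ncomp C).-1.*2,
      (forall u v, adj C u v -> node C u v != 0) /\
      (forall u v w, adj C u v -> adj C u w -> v != w ->
         ~~ same_point (node C u v) (node C u w)) &
      (forall i, mark C i != 0) /\
      (forall i v, adj C (cpt C i) v ->
         ~~ same_point (mark C i) (node C (cpt C i) v))].

Definition curve_iso C D : Prop :=
  exists (f : 'I_(ncomp C) -> 'I_(ncomp D)) (g : 'I_(ncomp C) -> 'M[K]_2),
    [/\ bijective f,
        forall u, g u \in unitmx,
        forall u v, adj D (f u) (f v) = adj C u v,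
        forall u v, adj C u v ->
          same_point (node C u v *m g u) (node D (f u) (f v)) &
        forall i, cpt D i = f (cpt C i) /\
          same_point (mark C i *m g (cpt C i)) (mark D i)].

(* The degree on the component u of the divisor K_C + \sum_i a_i s_i. *)
Definition log_degree (R : realType) (a : 'rV[R]_n) C (u : 'I_(ncomp C)) : R :=
  #|adj C u|%:R - 2 + \sum_(i | cpt C i == u) a 0 i.

(* A divisor on a connected nodal curve is ample iff its degree on every
   component is positive. *)
Definition stable (R : realType) (a : 'rV[R]_n) C : Prop :=
  [/\ genus0_nodal C,
      forall u : 'I_(ncomp C), 0 < log_degree a u &
      forall I : {set 'I_n},
        (forall i j, i \in I -> j \in I ->
           cpt C i = cpt C j /\ same_point (mark C i) (mark C j)) ->
        \sum_(i in I) a 0 i <= 1].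

(* The point of the component u at which the i-th marked point lies, or at
   which the part of the curve carrying the i-th marked point is attached:
   the image of s_i under the retraction of C onto u. *)
Definition retract C (u : 'I_(ncomp C)) (i : 'I_n) : 'rV[K]_2 :=
  if cpt C i == u then mark C i
  else if [pick w | adj C u w &&
             connect [rel x y | [&& adj C x y, x != u & y != u]] w (cpt C i)]
  is Some w then node C u w else 0.

(* C' is obtained from C by collapsing the component u (having at most two
   nodes) to a point; f identifies the components of C' with the remaining
   components of C.  If u has two nodes, its two neighbours become adjacent.
   The marked points on u move to the point to which u is collapsed. *)
Definition collapse C (u : 'I_(ncomp C)) (C' : curve K n) : Prop :=
  exists f : 'I_(ncomp C') -> 'I_(ncomp C),
    [/\ injective f,
        codom f =i predC1 u,
        forall v w, adj C' v w = adj C (f v) (f w)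
          || [&& v != w, adj C (f v) u & adj C u (f w)],
        forall v w, adj C' v w ->
          same_point (node C' v w)
            (if adj C (f v) (f w) then node C (f v) (f w)
             else node C (f v) u) &
        forall i, if cpt C i == u
          then adj C (f (cpt C' i)) u /\
               same_point (mark C' i) (node C (f (cpt C' i)) u)
          else f (cpt C' i) = cpt C i /\ same_point (mark C' i) (mark C i)].

Inductive collapses_to (R : realType) (b : 'rV[R]_n) :
    curve K n -> curve K n -> Prop :=
| collapses_refl C : collapses_to b C C
| collapses_step C (u : 'I_(ncomp C)) C' C'' :
    log_degree b u <= 0 -> collapse u C' -> collapses_to b C' C'' ->
    collapses_to b C C''.

Lemma same_pointP (p q : 'rV[K]_2) : reflect (p :=: q)%MS (same_point p q).
Proof. exact: eqmxP. Qed.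

Lemma same_point_mul (p q : 'rV[K]_2) (g : 'M[K]_2) :
  same_point p q -> same_point (p *m g) (q *m g).
Proof. by move=> /same_pointP pq; apply/same_pointP; exact: eqmxMr. Qed.

Lemma same_point_trans : transitive (@same_point K).
Proof.
move=> q p r /same_pointP pq /same_pointP qr.
by apply/same_pointP; exact: eqmx_trans qr.
Qed.

Lemma same_point_sym : symmetric (@same_point K).
Proof. by move=> p q; rewrite /same_point andbC. Qed.

Lemma curve_iso_refl C : curve_iso C C.
Proof.
exists id, (fun=> 1%:M); split => //; first by exists id.
- by move=> u; exact: unitmx1.
- by move=> u v _; rewrite mulmx1; apply/same_pointP.
- by move=> i; rewrite mulmx1; split=> //; apply/same_pointP.
Qed.

Lemma curve_iso_sym C D : curve_iso C D -> curve_iso D C.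
Proof.
move=> [f [g [[f' fK f'K] gU fadj fnode fmark]]].
exists f', (fun u => invmx (g (f' u))); split.
- by exists f.
- by move=> u; rewrite unitmx_inv.
- by move=> u v; rewrite -fadj !f'K.
- move=> u v uv; have uv' : adj C (f' u) (f' v) by rewrite -fadj !f'K.
  have := same_point_mul (invmx (g (f' u))) (fnode _ _ uv').
  by rewrite mulmxK// !f'K same_point_sym.
- move=> i; have [ci mi] := fmark i; rewrite ci fK; split => //.
  have := same_point_mul (invmx (g (cpt C i))) mi.
  by rewrite mulmxK// same_point_sym.
Qed.

Lemma curve_iso_trans D C E :
  curve_iso C D -> curve_iso D E -> curve_iso C E.
Proof.
move=> [f [g [bf gU fadj fnode fmark]]] [f' [g' [bf' gU' fadj' fnode' fmark']]].
exists (f' \o f), (fun u => g u *m g' (f u)); split => /=.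
- exact: bij_comp.
- by move=> u; rewrite unitmx_mul gU gU'.
- by move=> u v; rewrite fadj' fadj.
- move=> u v uv; rewrite mulmxA.
  apply: same_point_trans (same_point_mul _ (fnode _ _ uv)) _.
  by apply: fnode'; rewrite fadj.
- move=> i; have [ci mi] := fmark i; have [ci' mi'] := fmark' i.
  rewrite ci' ci mulmxA; split => //.
  by apply: same_point_trans (same_point_mul _ mi) _; rewrite -ci.
Qed.

End Curves.

Local Open Scope quotient_scope.
Local Open Scope classical_set_scope.

Definition stable_curve (K : numFieldType) (R : realType) (n : nat)
  (a : 'rV[R]_n) : Type := set_type [set C : curve K n | stable a C].

Section Moduli.
Variables (K : numFieldType) (R : realType) (n : nat) (a : 'rV[R]_n).

HB.instance Definition _ := Choice.on (stable_curve K a).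

(* The classical topology of the moduli space is the coarsest one for which
   all cross-ratios of four marked points are continuous on their domain of
   definition, itself required to be open.  The cross-ratio is computed on any
   component onto which the four points retract without three of them being
   identified; the value does not depend on that component.  The set below is
   the locus where the cross-ratio is defined, finite, and belongs to O;
   exchanging k and l inverts the cross-ratio, so that neighbourhoods of
   infinity are covered too. *)
Definition cross_ratio_in (q : 'I_n * 'I_n * 'I_n * 'I_n) (O : set K) :
    set (stable_curve K a) :=
  let: (i, j, k, l) := q in
  [set C | exists u : 'I_(ncomp (val C)),
    let d x y := det2 (retract u x) (retract u y) in
    d i l * d j k != 0 /\ O ((d i k * d j l) / (d i l * d j k))].

Definition cross_ratio_subbase : set (set (stable_curve K a)) :=
  [set U | exists i j k l (O : set K),
    [/\ uniq [:: i; j; k; l], open O & U = cross_ratio_in (i, j, k, l) O]].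

HB.instance Definition _ :=
  isSubBaseTopological.Build (stable_curve K a) cross_ratio_subbase id.

Definition stable_iso (C D : stable_curve K a) : bool :=
  `[< curve_iso (val C) (val D) >].

Lemma stable_iso_refl : reflexive stable_iso.
Proof. by move=> C; apply/asboolP; exact: curve_iso_refl. Qed.

Lemma stable_iso_sym : symmetric stable_iso.
Proof. by move=> C D; apply/asboolP/asboolP; exact: curve_iso_sym. Qed.

Lemma stable_iso_trans : transitive stable_iso.
Proof.
by move=> D C E /asboolP CD /asboolP DE; apply/asboolP/(curve_iso_trans CD DE).
Qed.

Definition stable_equiv : equiv_rel (stable_curve K a) :=
  EquivRel stable_iso stable_iso_refl stable_iso_sym stable_iso_trans.

Definition Mbar : Type := quotient_topology {eq_quot stable_equiv}.

HB.instance Definition _ := Topological.on Mbar.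

Definition Mbar_class (C : stable_curve K a) : Mbar :=
  \pi_Mbar C.

End Moduli.

Arguments Mbar K {R n} a.

(* An element L of G_{n,2} is represented by a 2 x n matrix of rank 2 whose rows
   span L, and its topology is the one induced by this representation.  The
   Pluecker coordinate P^{i,j}(L) is then, up to a common factor and up to
   sign, the minor of the columns i and j. *)
Definition pluecker (K : fieldType) n (M : 'M[K]_(2, n)) (i j : 'I_n) : K :=
  \det (row_mx (col i M) (col j M)).

Definition pluecker_support (K : fieldType) n (M : 'M[K]_(2, n)) :
    {set {set 'I_n}} :=
  [set I : {set 'I_n} | [exists i, exists j,
     (I == [set i; j]%SET) && (pluecker M i j != 0)]]%SET.

Definition main_support (n : nat) : {set {set 'I_n}} :=
  [set I : {set 'I_n} | #|I| == 2]%SET.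

(* The stratum W_sigma is non-empty. *)
Definition admissible (K : fieldType) n (sigma : {set {set 'I_n}}) : Prop :=
  exists M : 'M[K]_(2, n), \rank M = 2 /\ pluecker_support M = sigma.

Section ParameterSpace.
Variables (K : numFieldType) (n : nat) (omega : {set {set {set 'I_n}}}).

(* Representatives of the points of the union of the W_sigma, sigma \in omega. *)
Definition frame : Type :=
  set_type [set M : 'M[K]_(2, n) |
    \rank M = 2 /\ pluecker_support M \in omega].

HB.instance Definition _ := Topological.on frame.

Definition same_orbit (M N : frame) : bool :=
  `[< exists t : 'rV[K]_n, (forall i, t 0 i != 0) /\
        (val M *m diag_mx t == val N)%MS >].

Lemma same_orbit_refl : reflexive same_orbit.
Proof.
move=> M; apply/asboolP; exists (const_mx 1); split.
  by move=> i; rewrite mxE oner_neq0.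
by rewrite diag_const_mx mulmx1; apply/eqmxP.
Qed.

Lemma same_orbit_sym : symmetric same_orbit.
Proof.
suff H M N : same_orbit M N -> same_orbit N M.
  by move=> M N; apply/idP/idP; exact: H.
move=> /asboolP[t [t0 /eqmxP tMN]]; apply/asboolP.
exists (\row_i (t 0 i)^-1); split; first by move=> i; rewrite mxE invr_eq0.
apply/eqmxP; apply: eqmx_trans (eqmxMr _ (eqmx_sym tMN)) _.
rewrite -mulmxA mulmx_diag (_ : \row_i _ = const_mx 1) ?diag_const_mx ?mulmx1//.
by apply/rowP => i; rewrite !mxE mulfV.
Qed.

Lemma same_orbit_trans : transitive same_orbit.
Proof.
move=> N M P /asboolP[t [t0 /eqmxP MN]] /asboolP[s [s0 /eqmxP NP]].
apply/asboolP; exists (\row_i (t 0 i * s 0 i)); split.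
  by move=> i; rewrite mxE mulf_neq0.
apply/eqmxP; rewrite -mulmx_diag mulmxA.
exact: eqmx_trans (eqmxMr _ MN) NP.
Qed.

Definition orbit_equiv : equiv_rel frame :=
  EquivRel same_orbit same_orbit_refl same_orbit_sym same_orbit_trans.

(* F_omega, the union of the W_sigma / (K^* )^n, sigma \in omega. *)
Definition parameters : Type := quotient_topology {eq_quot orbit_equiv}.

HB.instance Definition _ := Topological.on parameters.

Definition parameters_class (M : frame) : parameters := \pi_parameters M.

End ParameterSpace.

(* F_n, the orbits of the main stratum W_n. *)
Definition main_parameters (K : numFieldType) (n : nat) : Type :=
  parameters K [set main_support n]%SET.

Section Chambers.
Variables (R : realType) (n : nat).
Implicit Types (S : set 'rV[R]_n) (sigma : {set {set 'I_n}}).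
Implicit Types (omega : {set {set {set 'I_n}}}).

Definition affine_hull S : set 'rV[R]_n :=
  [set y | exists k (x : 'I_k -> 'rV[R]_n) (w : 'I_k -> R),
    [/\ forall i, S (x i), \sum_i w i = 1 & y = \sum_i w i *: x i]].

Definition relative_interior S : set 'rV[R]_n :=
  [set x | S x /\ \forall y \near x, affine_hull S y -> S y].

Definition affine_dim S (d : nat) : Prop :=
  exists (x : 'rV[R]_n) (V : {vspace 'rV[R]_n}),
    \dim V = d /\ affine_hull S = [set x + v | v in [set` V]].

Definition indicator (I : {set 'I_n}) : 'rV[R]_n := \row_i (i \in I)%:R.

Definition polytope sigma : set 'rV[R]_n :=
  [set x | exists w : {set 'I_n} -> R,
    [/\ forall I, 0 <= w I, \sum_(I in sigma) w I = 1 &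
        x = \sum_(I in sigma) w I *: indicator I]].

Definition hypersimplex : set 'rV[R]_n :=
  [set x | (forall i, 0 <= x 0 i <= 1) /\ \sum_i x 0 i = 2].

Definition chamber omega : set 'rV[R]_n :=
  \bigcap_(sigma in [set` omega]) relative_interior (polytope sigma).

Definition is_chamber (K : fieldType) omega : Prop :=
  [/\ forall sigma, sigma \in omega -> admissible K sigma,
      chamber omega !=set0 &
      forall sigma, admissible K sigma -> sigma \notin omega ->
        chamber omega `&` relative_interior (polytope sigma) = set0].

Definition weight_domain : set 'rV[R]_n :=
  [set a | (forall i, 0 < a 0 i <= 1) /\ 2 < \sum_i a 0 i].

Definition wall (S : {set 'I_n}) : set 'rV[R]_n :=
  [set a | \sum_(i in S) a 0 i = 1].

Definition weight_domain_off_walls : set 'rV[R]_n :=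
  weight_domain `\`
    \bigcup_(S in [set S : {set 'I_n} | (2 <= #|S|)%N /\ (#|S| + 2 <= n)%N])
      wall S.

Definition is_weight_chamber (D : set 'rV[R]_n) : Prop :=
  exists2 a, weight_domain_off_walls a &
    D = connected_component weight_domain_off_walls a.

End Chambers.

Arguments chamber R {n} omega _.
Arguments hypersimplex R n _ : clear implicits.
Arguments is_chamber R {n} K omega.

Definition homeomorphism (X Y : topologicalType) (f : X -> Y) : Prop :=
  exists g : Y -> X, [/\ cancel f g, cancel g f, continuous f & continuous g].

Section Maps.
Variables (K : numFieldType) (R : realType) (n : nat).

(* C is the projective line marked by the columns of M. *)
Definition line_marked_by (C : curve K n) (M : 'M[K]_(2, n)) : Prop :=
  ncomp C = 1 /\ forall i, mark C i = (col i M)^T.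

(* The class of M is sent to the class of the projective line marked by the
   columns of M.  For omega the singleton of the main support this is the
   identification of F_n with M_{0,n}; it is the natural isomorphism of
   F_omega with the Hassett space of a if a lies in D_omega. *)
Definition natural_identification (omega : {set {set {set 'I_n}}})
    (a : 'rV[R]_n) (h : parameters K omega -> Mbar K a) : Prop :=
  forall M : frame K omega, exists2 C : stable_curve K a,
    line_marked_by (val C) (val M) & h (parameters_class M) = Mbar_class C.

Definition extends_identity (omega : {set {set {set 'I_n}}}) (X : Type)
    (iota : main_parameters K n -> X) (p : X -> parameters K omega) : Prop :=
  forall M : frame K [set main_support n]%SET, exists2 N : frame K omega,
    val N = val M & p (iota (parameters_class M)) = parameters_class N.

Definition reduction_morphism (a b : 'rV[R]_n)
    (rho : Mbar K a -> Mbar K b) : Prop :=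
  forall C : stable_curve K a, exists2 D : stable_curve K b,
    collapses_to b (val C) (val D) & rho (Mbar_class C) = Mbar_class D.

End Maps.

(* Main.v *)
(* Let [z] correspond to the stable curve [C], let [D] be the [B]-stable curve
   obtained by collapsing [C], and let [E] be the line marked by a frame
   representing [p z]. The hypothesis on [D_omega] forces [D] to be irreducible,
   so [D] is a component [u] of [C] marked by the retractions of the marked
   points onto [u]. The point [z] is a limit of points of the main stratum, along
   which the cross-ratios tend both to those of [D] and to those of [E]. Only
   marked points of total weight at most 1 coincide, and the total weight exceeds
   2, so by Koenig's theorem some three marked points are distinct in [D] and in
   [E]; the projectivity matching these three carries [E] to [D].
   Density of the main stratum is proved by smoothing all nodes of [C] at once:
   the coordinates on the components are glued along the tree of components by
   matrices depending on a parameter [t] which have rank 1 at [t = 0]. *)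
Require Import Defs.
From HB Require Import structures.
From mathcomp Require Import all_boot all_order all_algebra.
From mathcomp Require Import all_classical all_reals all_analysis.
From mathcomp Require Import complex finmap ring lra.
Set Implicit Arguments.
Unset Strict Implicit.
Unset Printing Implicit Defensive.
Import Order.TTheory GRing.Theory Num.Theory.
Import numFieldNormedType.Exports.
Local Open Scope ring_scope.

(** * Points of the projective line *)

Section Det2.
Variable K : fieldType.
Implicit Types (p q y : 'rV[K]_2) (g : 'M[K]_2) (c : K).

Lemma det_mx22 g : \det g = g 0 0 * g 1 1 - g 0 1 * g 1 0.
Proof.
rewrite (expand_det_row _ 0) !big_ord_recl big_ord0 addr0 /cofactor !det_mx11.
rewrite !mxE /= expr0 expr1 mul1r mulN1r mulrN.
by congr (_ * g _ _ - g _ _ * g _ _); apply: val_inj.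
Qed.

Lemma det2E p q : det2 p q = p 0 0 * q 0 1 - p 0 1 * q 0 0.
Proof.
rewrite /det2 det_mx22.
have e0 j : col_mx p q 0 j = p 0 j.
  by rewrite -(col_mxEu p q 0 j); congr (_ _ _); apply: val_inj.
have e1 j : col_mx p q 1 j = q 0 j.
  by rewrite -(col_mxEd p q 0 j); congr (_ _ _); apply: val_inj.
by rewrite !e0 !e1.
Qed.

Lemma rV2P p q : p 0 0 = q 0 0 -> p 0 1 = q 0 1 -> p = q.
Proof.
move=> e0 e1; apply/rowP => j.
by case: (unliftP 0 j) => [j'|] -> //; rewrite ord1 (_ : lift 0 0 = 1) //; apply: val_inj.
Qed.

Lemma det2_mulmx p q g : det2 (p *m g) (q *m g) = det2 p q * \det g.
Proof. by rewrite /det2 -mul_col_mx det_mulmx. Qed.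

Lemma det2Z c1 c2 p q : det2 (c1 *: p) (c2 *: q) = c1 * c2 * det2 p q.
Proof. by rewrite !det2E !mxE; ring. Qed.

Lemma det2C p q : det2 p q = - det2 q p.
Proof. by rewrite !det2E; ring. Qed.

Lemma det2_diag p : det2 p p = 0.
Proof. by rewrite det2E; ring. Qed.

Lemma det2_cramer p q y : det2 p q *: y = det2 y q *: p + det2 p y *: q.
Proof. by apply: rV2P; rewrite !mxE !det2E; ring. Qed.

Lemma same_pointZ c p : c != 0 -> same_point p (c *: p).
Proof. by move=> c0; apply/same_pointP/eqmx_sym/eqmx_scale. Qed.

Lemma same_pointE p q : p != 0 -> q != 0 -> same_point p q = (det2 p q == 0).
Proof.
move=> p0 q0; apply/idP/eqP => [/andP[/sub_rVP[c ->] _]|pq0].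
  by rewrite -[q in det2 _ q]scale1r det2Z det2_diag mulr0.
have [c cp] : exists c, q = c *: p.
  have [j pj0] : exists j, p 0 j != 0.
    apply/existsP; apply: contraNT p0; rewrite negb_exists => /forallP pj.
    by apply/eqP/rowP => j; rewrite mxE; apply/eqP; have := pj j; rewrite negbK.
  exists (q 0 j / p 0 j).
  have H : forall y, p 0 0 * y 0 1 = p 0 1 * y 0 0 -> p 0 j != 0 -> y = (y 0 j / p 0 j) *: p.
    move=> y E; have [->|->] : j = 0 \/ j = 1.
      case: (unliftP 0 j) => [j'|] ->; [right|by left].
      by rewrite ord1; apply: val_inj.
    - move=> u; apply: rV2P; rewrite !mxE; first by field.
      by apply: (mulfI u); rewrite E; field.
    - move=> u; apply: rV2P; rewrite !mxE; last by field.
      by apply: (mulfI u); rewrite -E; field.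
  by apply: H => //; apply/eqP; rewrite -subr_eq0 -det2E pq0.
rewrite cp; apply: same_pointZ.
by apply: contraNneq q0 => c0; rewrite cp c0 scale0r.
Qed.

Lemma same_point_scale p q :
  same_point p q -> q != 0 -> exists2 c, c != 0 & q = c *: p.
Proof.
move=> /andP[_ /sub_rVP[c cp]] q0; exists c => //.
by apply: contraNneq q0 => c0; rewrite cp c0 scale0r.
Qed.

Lemma det2_neq0l p q : det2 p q != 0 -> p != 0.
Proof.
by apply: contraNneq => ->; rewrite det2E !mxE !mul0r subrr.
Qed.

Lemma mulmx_unit_neq0 p g : g \in unitmx -> p != 0 -> p *m g != 0.
Proof.
by move=> gU; apply: contraNneq => pg; rewrite -(mulmxK gU p) pg mul0mx.
Qed.

Lemma det2Dl p q y : det2 (p + q) y = det2 p y + det2 q y.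
Proof. by rewrite !det2E !mxE; ring. Qed.

(** Completes the point of a node to a basis of determinant 1, from which the gluing matrices below
    are built. *)
Lemma det2_dual p : p != 0 -> exists q, det2 p q = 1.
Proof.
move=> p0; have [p00|p00] := eqVneq (p 0 0) 0.
  have p01 : p 0 1 != 0 by apply: contraNneq p0 => p01; apply/eqP/rV2P; rewrite mxE.
  exists (- (p 0 1)^-1 *: delta_mx 0 0).
  by rewrite det2E !mxE p00 /=; field.
exists ((p 0 0)^-1 *: delta_mx 0 1).
by rewrite det2E !mxE /=; field.
Qed.

(** For nonzero [p] and [q], an endomorphism of the plane with kernel the line [p] and image the
    line [q], normalised as in [mul_rank_one]. *)
Definition rank_one p q : 'M[K]_2 := (\col_a (if a == 0 then - p 0 1 else p 0 0)) *m q.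

Lemma mul_rank_one y p q : y *m rank_one p q = det2 p y *: q.
Proof.
rewrite /rank_one mulmxA [y *m _]mx11_scalar mul_scalar_mx; congr (_ *: _).
rewrite !mxE !big_ord_recl big_ord0 !mxE /= det2E.
by rewrite (_ : lift 0 0 = 1 :> 'I_2); [ring|exact: val_inj].
Qed.

Lemma eq_mulmx_rows m (g h : 'M[K]_(2, m)) : (forall y, y *m g = y *m h) -> g = h.
Proof. by move=> gh; apply/row_matrixP => i; rewrite !rowE. Qed.

(** As a function of [d l], the coordinate with value 0 at [d j], value 1 at [d k] and a pole at
    [d i]. *)
Definition cross_ratio (I : Type) (d : I -> 'rV[K]_2) (i j k l : I) : K :=
  (det2 (d i) (d k) * det2 (d j) (d l)) / (det2 (d i) (d l) * det2 (d j) (d k)).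

(** Every determinant acquires the scalars of its two points and a factor [(\det g)^-1]; each index
    occurs once above and once below, so all these factors cancel. *)
Lemma cross_ratio_proj (I : Type) (d e : I -> 'rV[K]_2) g (s : I -> K) i j k l :
  g \in unitmx -> (forall i, s i != 0) -> (forall i, e i *m g = s i *: d i) ->
  det2 (d i) (d l) * det2 (d j) (d k) != 0 ->
  det2 (e i) (e l) * det2 (e j) (e k) != 0 /\
  cross_ratio e i j k l = cross_ratio d i j k l.
Proof.
move=> gU s0 eE dd.
have g0 : \det g != 0 by rewrite -unitfE -unitmxE.
have E (x y : I) : det2 (e x) (e y) = s x * s y * det2 (d x) (d y) / \det g.
  by rewrite -det2Z -!eE det2_mulmx mulfK.
rewrite /cross_ratio !E; move: dd; rewrite mulf_eq0 negb_or => /andP[dil djk].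
split; first by rewrite !mulf_neq0 ?invr_eq0.
by field; rewrite g0 !s0 dil djk.
Qed.

(** The projectivity is determined by its effect on three points and is written down explicitly; the
    last hypothesis then says, up to nonzero factors, that [det2 (e l *m g) (d l)] vanishes. *)
Lemma frame_projectivity (I : Type) (d e : I -> 'rV[K]_2) (i j k : I) :
  det2 (d i) (d j) != 0 -> det2 (d i) (d k) != 0 -> det2 (d j) (d k) != 0 ->
  det2 (e i) (e j) != 0 -> det2 (e i) (e k) != 0 -> det2 (e j) (e k) != 0 ->
  (forall l, d l != 0) -> (forall l, e l != 0) ->
  (forall l,
     det2 (d i) (d k) * det2 (d j) (d l) * (det2 (e i) (e l) * det2 (e j) (e k)) =
     det2 (e i) (e k) * det2 (e j) (e l) * (det2 (d i) (d l) * det2 (d j) (d k))) ->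
  exists2 g, g \in unitmx & forall l, same_point (e l *m g) (d l).
Proof.
move=> dij dik djk eij eik ejk d0 e0 CR.
(* Any such combination carries the lines of [e i] and [e j] to those of [d i] and [d j]; by
   Cramer's rule, these [a] and [b] make it send [e k] to a multiple of [d k]. *)
set a := det2 (d j) (d k) / det2 (e j) (e k).
set b := det2 (d i) (d k) / det2 (e i) (e k).
pose g := - a *: rank_one (e j) (d i) + b *: rank_one (e i) (d j).
have gE y : y *m g = (det2 y (e j) * a) *: d i + (det2 (e i) y * b) *: d j.
  by rewrite mulmxDr -!scalemxAr !mul_rank_one !scalerA (det2C y); congr (_ *: _ + _ *: _); ring.
have gU : g \in unitmx.
  have := det2_mulmx (e i) (e j) g; rewrite !gE !det2_diag !mul0r !scale0r addr0 add0r.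
  rewrite det2Z => E; rewrite unitmxE unitfE; apply: contraTneq isT => g0.
  move: E; rewrite g0 mulr0 => /eqP; rewrite !mulf_eq0 !invr_eq0.
  by rewrite (negPf eij) (negPf dij) (negPf djk) (negPf dik) (negPf eik) (negPf ejk).
exists g => // l; rewrite same_pointE ?mulmx_unit_neq0// gE det2Dl.
rewrite -[d l]scale1r !det2Z !mulr1.
apply/eqP; rewrite (det2C (e l)) /a /b.
apply: (mulfI ejk); apply: (mulfI eik); rewrite !mulr0.
transitivity (det2 (d i) (d k) * det2 (d j) (d l) * (det2 (e i) (e l) * det2 (e j) (e k)) -
     det2 (e i) (e k) * det2 (e j) (e l) * (det2 (d i) (d l) * det2 (d j) (d k))).
  by field; rewrite eik ejk.
by rewrite CR subrr.
Qed.

End Det2.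

(** * Common transversals of two partitions *)

Section Konig.
Variables (R : realDomainType) (n : nat) (b : 'I_n -> R).
Hypothesis b_ge0 : forall i, 0 <= b i.
Hypothesis b_gt2 : 2 < \sum_i b i.

(** Two sets of weight at most 1 have a union of weight at most 2, which is less than the total. *)
Lemma heavy_uncovered (P Q : pred 'I_n) :
  \sum_(i | P i) b i <= 1 -> \sum_(i | Q i) b i <= 1 ->
  exists i, ~~ P i /\ ~~ Q i.
Proof.
move=> P1 Q1; suff /existsP[i /andP[? ?]] : [exists i, ~~ P i && ~~ Q i] by exists i.
apply: contraTT b_gt2 => /existsPn PQ; rewrite -leNgt.
apply: le_trans (lerD P1 Q1); rewrite [leRHS]addrC.
rewrite (bigID P) /= addrC lerD2r big_mkcond [leRHS]big_mkcond ler_sum// => i _.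
by have := PQ i; case: (P i); case: (Q i).
Qed.

(* Koenig: in the bipartite graph whose edges are the indices and whose vertices
   are the blocks of the two partitions, two vertices never cover all edges, so
   there is a matching of size 3. *)
Lemma common_transversal (S T : eqType) (d : 'I_n -> S) (e : 'I_n -> T) :
  (forall i, \sum_(j | d j == d i) b j <= 1) ->
  (forall i, \sum_(j | e j == e i) b j <= 1) ->
  exists i j k, uniq [:: d i; d j; d k] && uniq [:: e i; e j; e k].
Proof.
move=> d1 e1.
have [i _] : exists i : 'I_n, ~~ false /\ ~~ false.
  by apply: (@heavy_uncovered (fun=> false) (fun=> false)); rewrite big_pred0_eq ler01.
have [j [dji eji]] := heavy_uncovered (d1 i) (e1 i).
have dd s t : exists x, d x != d s /\ d x != d t by exact: heavy_uncovered (d1 s) (d1 t).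
have ee s t : exists x, e x != e s /\ e x != e t by exact: heavy_uncovered (e1 s) (e1 t).
have de s t : exists x, d x != d s /\ e x != e t by exact: heavy_uncovered (d1 s) (e1 t).
have U (s t u : 'I_n) : d s != d t -> d s != d u -> d t != d u ->
    e s != e t -> e s != e u -> e t != e u ->
    exists i j k, uniq [:: d i; d j; d k] && uniq [:: e i; e j; e k].
  by move=> *; exists s, t, u; rewrite /= !inE !negb_or; apply/andP; split; repeat (apply/andP; split).
have [x [dxi dxj]] := dd i j.
have [y [eyi eyj]] := ee i j.
(* If [e x] avoids both [e i] and [e j], then [x], [i], [j] is a transversal; the case [e x = e j]
   is the present one with [i] and [j] exchanged. *)
wlog exi : i j dji eji dxi dxj eyi eyj / e x = e i.
  move=> W; have [|exi] := eqVneq (e x) (e i); first exact: (W i j).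
  have [|exj] := eqVneq (e x) (e j); first by apply: (W j i) => //; rewrite eq_sym.
  by apply: (U x i j) => //; rewrite eq_sym.
have [dyi|dyi] := eqVneq (d y) (d i).
  apply: (U x y j); rewrite ?dyi ?exi// eq_sym//.
have [dyj|dyj] := eqVneq (d y) (d j); last first.
  by apply: (U y i j); rewrite // eq_sym.
(* The edges [i], [j], [x], [y] all meet [d j] or [e i]. An edge [k] avoiding these two vertices
   permits an augmentation of the matching, whichever of [d i] and [e j] it meets. *)
have [k [dkj eki]] := de j i.
have [dki|dki] := eqVneq (d k) (d i).
  have [ekj|ekj] := eqVneq (e k) (e j).
    apply: (U k x y); rewrite ?dki ?dyj ?exi ?ekj// eq_sym//.
  by apply: (U k x j); rewrite ?dki ?exi// eq_sym//.
have [ekj|ekj] := eqVneq (e k) (e j).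
  by apply: (U k y i); rewrite ?dyj ?ekj// eq_sym//.
by apply: (U k i j); rewrite // eq_sym.
Qed.

End Konig.

(** * The tree of components and retractions *)

Section RootedTree.
Variables (V : finType) (e : rel V).
Hypothesis e_sym : symmetric e.
Hypothesis e_conn : forall u v, connect e u v.
Hypothesis e_card : #|[set p : V * V | e p.1 p.2]%SET| = #|V|.-1.*2.

(** The field [par_edge] expresses acyclicity: the graph has no edges besides those of the spanning
    tree. *)
Record rooting (r : V) (par : V -> V) (depth : V -> nat) : Prop := Rooting {
  depth_root : depth r = 0;
  depth_par : forall v, v != r -> depth v = (depth (par v)).+1;
  edge_par : forall v, v != r -> e v (par v);
  par_edge : forall v w, e v w -> (v != r /\ w = par v) \/ (w != r /\ v = par w) }.

(* The breadth-first spanning tree has as many edges as the graph. *)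
Lemma tree_rooting (r : V) : exists par depth, rooting r par depth.
Proof.
pose reach v k := `[< exists p, [/\ path e r p, last r p = v & size p = k] >].
have exr v : exists k, reach v k.
  have /connectP[p ep lp] := e_conn r v.
  by exists (size p); apply/asboolP; exists p.
pose depth v := ex_minn (exr v).
have depthP v : exists p, [/\ path e r p, last r p = v & size p = depth v].
  by rewrite /depth; case: ex_minnP => k /asboolP.
have depth_min v p : path e r p -> last r p = v -> (depth v <= size p)%N.
  move=> ep lp; rewrite /depth; case: ex_minnP => k _; apply.
  by apply/asboolP; exists p.
have dr : depth r = 0 by apply/eqP; rewrite -leqn0 (@depth_min r [::]).
have up v : v != r -> exists w, e v w && (depth v == (depth w).+1).
  move=> vr; have [p []] := depthP v.
  case/lastP: p => [|p w]; first by move=> _ /= rv; rewrite rv eqxx in vr.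
  rewrite rcons_path last_rcons size_rcons => /andP[ep ew] wv dv.
  have le_p : (depth (last r p) <= size p)%N by exact: depth_min.
  have le_v : (depth v <= (depth (last r p)).+1)%N.
    have [q [eq lq <-]] := depthP (last r p).
    by rewrite -(size_rcons q v) depth_min ?rcons_path ?last_rcons// eq lq -wv.
  by exists (last r p); rewrite e_sym -[v in e _ v]wv ew eqn_leq le_v -dv ltnS.
pose par v := odflt v [pick w | e v w && (depth v == (depth w).+1)].
have parP v : v != r -> e v (par v) /\ depth v = (depth (par v)).+1.
  move=> /up[w vw]; rewrite /par; case: pickP => [x /andP[? /eqP]//|/(_ w)].
  by rewrite vw.
exists par, depth; split=> //; try by move=> v /parP[].
(* The two orientations of the parent edges are disjoint because the depth drops along [par]; by
   counting they exhaust all edges. *)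
pose A1 := [set (v, par v) | v in [set~ r]]%SET.
pose A2 := [set (par v, v) | v in [set~ r]]%SET.
have A12 : [set p : V * V | e p.1 p.2]%SET = (A1 :|: A2)%SET.
  apply/esym/eqP; rewrite eqEcard; apply/andP; split.
    apply/fintype.subsetP => -[x y]; rewrite !inE => /orP[] /imsetP[v];
      rewrite !inE => /parP[vp _] [-> ->] //.
    by rewrite /= e_sym.
  rewrite e_card cardsU (_ : A1 :&: A2 = finset.set0)%SET.
    rewrite cards0 subn0 !card_imset; try by move=> ? ? [].
    by rewrite cardsC1 addnn.
  apply/setP => -[x y]; rewrite !inE; apply/negP => /andP[].
  move=> /imsetP[v + [-> ->]] /imsetP[w + [vw wv]]; rewrite !inE.
  move=> /parP[_ dv] /parP[_]; rewrite -vw -wv => dw.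
  by move: dv; rewrite dw => /eqP; rewrite -[X in X == _]addn0 -addn2 eqn_add2l.
move=> v w vw; have : (v, w) \in (A1 :|: A2)%SET by rewrite -A12 inE.
by rewrite inE => /orP[] /imsetP[x]; rewrite !inE => xr [-> ->]; [left|right].
Qed.

(** With the tree rooted at [u], the ancestor at depth 1 is constant along edges avoiding [u], and
    is the vertex itself for a neighbour of [u]. *)
Lemma tree_branch_uniq (u w w' x : V) : e u w -> e u w' ->
  connect [rel x y | [&& e x y, x != u & y != u]] w x ->
  connect [rel x y | [&& e x y, x != u & y != u]] w' x -> w = w'.
Proof.
have [par [depth [d0 dpar epar pedge]]] := tree_rooting u.
pose branch v := iter (depth v).-1 par v.
have branch_edge x' y : [&& e x' y, x' != u & y != u] -> branch x' = branch y.
  have step v : v != u -> par v != u -> branch v = branch (par v).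
    move=> vu pu; rewrite /branch (dpar _ vu) /= (dpar _ pu) /=.
    by rewrite -iterSr.
  move=> /and3P[/pedge[[_ ->]|[_ ->]] xu yu]; first exact: step.
  by rewrite -step.
have branch_root v : e u v -> branch v = v.
  move=> /pedge[[]|[vu uv]]; first by rewrite eqxx.
  by rewrite /branch dpar// -uv d0.
have branch_path v : connect [rel x y | [&& e x y, x != u & y != u]] v x -> branch v = branch x.
  move=> /connectP[p + ->]; elim: p v => //= y p IH v /andP[vy yp].
  by rewrite (branch_edge _ _ vy) IH.
by move=> uw uw' /branch_path wx /branch_path w'x; rewrite -(branch_root _ uw) wx -w'x branch_root.
Qed.

End RootedTree.

Section Retraction.
Variables (K : fieldType) (n : nat).
Implicit Types (C : curve K n).

Definition off_edge C (u : 'I_(ncomp C)) : rel 'I_(ncomp C) :=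
  [rel x y | [&& adj C x y, x != u & y != u]].

(** A relational form of [retract], involving no choice of branch and insensitive to scaling, which
    can be followed through collapses. *)
Definition retracts_to C (u : 'I_(ncomp C)) (i : 'I_n) (p : 'rV[K]_2) : Prop :=
  (cpt C i = u /\ same_point (mark C i) p) \/
  exists w, [/\ adj C u w, w != u, connect (off_edge u) w (cpt C i) & same_point (node C u w) p].

(** A path in [C'] lifts to [C], with a detour through [u] at each new edge, and whatever a collapse
    moves to a point of a component was already attached there by the node leading to [u]. *)
Lemma retracts_to_collapse C (u : 'I_(ncomp C)) C' : collapse u C' ->
  exists f : 'I_(ncomp C') -> 'I_(ncomp C), forall v i p,
    retracts_to v i p -> retracts_to (f v) i p.
Proof.
move=> [f [finj fcod fadj fnode fmark]]; exists f => v i p.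
have fu w : f w != u.
  by have := codom_f f w; rewrite fcod inE.
have edge x y : off_edge v x y -> connect (off_edge (f v)) (f x) (f y).
  move=> /and3P[+ xv yv]; rewrite fadj => /orP[xy|/and3P[_ xu uy]].
    by apply: connect1; rewrite /off_edge /= xy !(inj_eq finj) xv.
  apply: (@connect_trans _ _ u); apply: connect1; rewrite /off_edge /=;
    by rewrite ?xu ?uy !(inj_eq finj) ?xv ?yv eq_sym fu.
have conn x y : connect (off_edge v) x y -> connect (off_edge (f v)) (f x) (f y).
  move=> /connectP[q + ->]; elim: q x => //= z q IH x /andP[/edge xz /IH].
  exact: connect_trans.
have fi := fmark i.
case=> [[iv ip]|[w [vw wv wi wp]]].
  move: fi; case: eqP => [iu|_] [fi fm]; last first.
    left; split; first by rewrite -fi iv.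
    by apply: same_point_trans ip; rewrite same_point_sym.
  right; exists u; split.
  - by rewrite -iv.
  - by rewrite eq_sym fu.
  - by rewrite iu connect0.
  - by apply: same_point_trans ip; rewrite same_point_sym -iv.
(* When the edge from [v] to [w] was created by the collapse, the branch hangs on [f v] through
   [u]. *)
right; set x := if adj C (f v) (f w) then f w else u.
have wi' : connect (off_edge (f v)) (f w) (cpt C i).
  have [iv|iv] := eqVneq (cpt C' i) v.
    have closed a : connect (off_edge v) a (cpt C' i) -> a = v.
      move=> /connectP[q]; rewrite iv; elim/last_ind: q => //= q z _.
      by rewrite rcons_path last_rcons => /andP[_ /and3P[_ _ /negP zv]] vz; case: zv; rewrite vz.
    by rewrite (closed _ wi) eqxx in wv.
  move: fi; case: eqP => [iu|_] [fi _]; last by rewrite -fi conn.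
  rewrite iu; apply: connect_trans (conn _ _ wi) _; apply: connect1.
  by rewrite /off_edge /= fi inj_eq// iv eq_sym fu.
exists x; split.
- by rewrite /x; case: ifPn => // nvw; move: vw; rewrite fadj (negPf nvw) => /and3P[].
- by rewrite /x; case: ifP; rewrite ?inj_eq// eq_sym fu.
- rewrite /x; case: ifPn => // nvw; apply: connect_trans wi'; apply: connect1.
  move: (vw); rewrite fadj (negPf nvw) => /and3P[_ _ uw].
  by rewrite /off_edge /= uw inj_eq// wv andbT eq_sym fu.
- apply: same_point_trans wp; rewrite same_point_sym.
  by have := fnode _ _ vw; rewrite /x; case: ifP.
Qed.

Lemma genus0_card C : genus0_nodal C ->
  #|[set p : 'I_(ncomp C) * 'I_(ncomp C) | adj C p.1 p.2]%SET| = #|'I_(ncomp C)|.-1.*2.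
Proof. by case=> _ _ ->; rewrite card_ord. Qed.

Lemma genus0_sym C : genus0_nodal C -> symmetric (adj C).
Proof. by case=> -[]. Qed.

(** Rules out the default value 0 in [retract]: a path from [u] without repetitions never returns to
    [u] after its first step. *)
Lemma retract_cases C (u : 'I_(ncomp C)) i : genus0_nodal C ->
  (cpt C i = u /\ retract u i = mark C i) \/
  exists w, [/\ adj C u w, connect (off_edge u) w (cpt C i) & retract u i = node C u w].
Proof.
move=> gC; rewrite /retract; case: eqP => [|/eqP iu]; [by left|right].
have [[_ irr] [_ conn] _ _ _] := gC.
case: pickP => [w /andP[uw wi]|no]; first by exists w.
have /connectP[p /shortenP[q qp uq _] lp] := conn u (cpt C i).
case: q qp uq lp => [_ _ /= iu'|w q /= /andP[uw wq] /andP[uq _] lq].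
  by rewrite iu' eqxx in iu.
case/negP: (negbT (no w)); rewrite uw /=; apply/connectP; exists q => //.
have : u \notin w :: q by [].
elim: q w wq {uw uq lq} => //= y q IH w /andP[wy yq].
rewrite inE negb_or => /andP[uw uq]; rewrite IH// andbT wy /= eq_sym uw.
by move: uq; rewrite inE negb_or eq_sym => /andP[].
Qed.

(** In a tree the branch at [u] containing a given component is unique, so the choice made in
    [retract] does not matter. *)
Lemma retracts_toP C (u : 'I_(ncomp C)) i p :
  genus0_nodal C -> retracts_to u i p -> same_point (retract u i) p.
Proof.
move=> gC; have [[_ irr] _ _ _ _] := gC.
have notu w : adj C u w -> ~ connect (off_edge u) w u.
  move=> uw /connectP[q]; elim/last_ind: q => /= [_ wu|q z _].
    by move: uw; rewrite -wu (negPf (irr _)).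
  by rewrite rcons_path last_rcons => /andP[_ /and3P[_ _ /negP zu]] uz; case: zu; rewrite uz.
have [[iu ->]|[w [uw wi ->]]] := retract_cases u i gC.
  by case=> [[]//|[w [uw _]]]; rewrite iu => /(notu _ uw).
case=> [[iu]|[w' [uw' _ wi']]]; first by move: wi; rewrite iu => /(notu _ uw).
have [_ [_ conn] _ _ _] := gC.
by have -> := tree_branch_uniq (genus0_sym gC) conn (genus0_card gC) uw uw' wi wi'.
Qed.

Lemma retract_neq0 C (u : 'I_(ncomp C)) i : genus0_nodal C -> retract u i != 0 :> 'rV[K]_2.
Proof.
move=> gC; have [_ _ _ [node0 _] [mark0 _]] := gC.
by have [[_ ->]|[w [uw _ ->]]] := retract_cases u i gC; rewrite ?mark0 ?node0.
Qed.

Lemma ncomp1_retract C (u : 'I_(ncomp C)) i : ncomp C = 1 -> retract u i = mark C i.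
Proof.
by move=> C1; rewrite /retract (_ : cpt C i = u) ?eqxx//; move: (cpt C i) u; rewrite C1 => a b; rewrite !ord1.
Qed.

(** The induction runs on [retracts_to], which asks for no tree structure on the intermediate
    curves. *)
Lemma collapses_to_retract (R : realType) (b : 'rV[R]_n) C D :
  collapses_to b C D -> genus0_nodal C -> ncomp D = 1 ->
  exists u : 'I_(ncomp C), forall i, same_point (retract u i) (mark D i).
Proof.
move=> CD gC D1.
suff [u H] : exists u : 'I_(ncomp C), forall i, retracts_to u i (mark D i).
  by exists u => i; exact: retracts_toP.
elim: CD D1 {gC} => [C'|C' u C'' D' _ /retracts_to_collapse[f Hf] _ IH] D1.
  have lt01 : (0 < ncomp C')%N by rewrite D1.
  exists (Ordinal lt01) => i; left; split; last exact/same_pointP.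
  by apply: val_inj; case: (cpt C' i) => -[]//= m; rewrite D1.
by have [u' H] := IH D1; exists (f u') => i; exact: Hf.
Qed.

End Retraction.

(** * Weight chambers *)

Section HeavySplit.
Variables (K : fieldType) (R : realType) (n : nat) (b : 'rV[R]_n).

Lemma sum_degrees (C : curve K n) : genus0_nodal C ->
  (\sum_u #|adj C u| = (ncomp C).-1.*2)%N.
Proof.
move=> [_ _ <- _ _]; rewrite -[RHS]sum1_card.
rewrite [RHS](eq_bigl (fun p => adj C p.1 p.2)); last by move=> p; rewrite inE.
rewrite -(pair_big_dep predT (fun u v => adj C u v) (fun=> fun=> 1%N)) /=.
by apply: eq_bigr => u _; rewrite sum1_card.
Qed.

(** The nodes contribute twice the number of edges, which is two less than twice the number of
    components. *)
Lemma sum_log_degrees (C : curve K n) : genus0_nodal C ->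
  \sum_(u : 'I_(ncomp C)) log_degree b u = \sum_i b 0 i - 2.
Proof.
move=> gC; rewrite /log_degree !big_split /= addrC -natr_sum sum_degrees//.
congr (_ + _).
  by rewrite (partition_big (cpt C) predT).
rewrite sumr_const card_ord; have [_ [m0 _] _ _ _] := gC.
case: (ncomp C) m0 => // m _; rewrite succnK -mulNrn -mul2n natrM -[in RHS]mulN1r.
rewrite -mulr_natr -natr1; ring.
Qed.

(* [S] is the set of marked points on a leaf of the tree of components. *)
Lemma stable_heavy_split (C : curve K n) : stable b C -> ncomp C <> 1 ->
  exists S : {set 'I_n}, 1 < \sum_(i in S) b 0 i /\ 1 < \sum_(i in ~: S) b 0 i.
Proof.
move=> [gC pos _] C1.
have [_ [m0 conn] _ _ _] := gC.
(* A leaf exists because the average degree in a tree is less than 2. *)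
have [u u1] : exists u, (#|adj C u| <= 1)%N.
  apply/existsP; apply: contraT => /existsPn H.
  have : (\sum_(u : 'I_(ncomp C)) 2 <= \sum_u #|adj C u|)%N.
    by apply: leq_sum => u _; rewrite ltnNge H.
  rewrite sum_degrees// sum_nat_const card_ord muln2 leq_double.
  by case: (ncomp C) m0 => // m _; rewrite ltnn.
have [v vu] : exists v, v != u.
  case: (unliftP u (Ordinal m0)) => [v' vE|uE]; first by exists (Ordinal m0); rewrite vE eq_sym neq_lift.
  have m1 : (1 < ncomp C)%N by rewrite ltn_neqAle m0 andbT eq_sym; apply/eqP.
  by exists (Ordinal m1); apply/eqP => /(congr1 val); rewrite -uE.
have uE : #|adj C u| = 1%N.
  apply/eqP; rewrite eqn_leq u1 lt0n; apply/negP => /eqP/card0_eq a0.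
  have /connectP[[|w q] /=] := conn u v; first by move=> _ vE; rewrite vE eqxx in vu.
  by have /= := a0 w; rewrite -[w \in _]/(adj C u w) => ->.
(* By [sum_log_degrees], the total degree of the components other than [u] is the weight of the
   marks off [u] minus 1. *)
have other : 0 < \sum_(w | w != u) log_degree b w.
  rewrite (bigD1 v)//= ltr_pwDl//; apply: sumr_ge0 => w _; exact: ltW.
exists [set i | cpt C i == u]%SET.
have Su : \sum_(i in [set i | cpt C i == u]%SET) b 0 i = log_degree b u + 1.
  rewrite /log_degree uE; transitivity (\sum_(i | cpt C i == u) b 0 i); last by ring.
  by apply: eq_bigl => i; rewrite inE.
split; first by rewrite Su ltrDr pos.
have := sum_log_degrees gC; rewrite (bigD1 u)//=.
rewrite (bigID (mem [set i | cpt C i == u]%SET) predT)/= Su => E.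
rewrite (eq_bigl (fun i => i \notin [set i | cpt C i == u]%SET)); last by move=> i; rewrite !inE.
by lra.
Qed.

End HeavySplit.

Section WeightChambers.
Variables (R : realType) (n : nat).
Implicit Types (S : {set 'I_n}) (a b : 'rV[R]_n).
Local Open Scope classical_set_scope.

Lemma weight_continuous S : continuous (fun a : 'rV[R]_n => \sum_(i in S) a 0 i).
Proof.
elim: (index_enum _) => [|i s IH].
  by under eq_fun do rewrite big_nil; exact: cst_continuous.
under eq_fun do rewrite big_cons.
case: (i \in S); last exact: IH.
by move=> a; exact: (cvgD (@coord_continuous _ _ _ 0 i a) (IH a)).
Qed.

Lemma heavy_card a S : (forall i, a 0 i <= 1) ->
  1 < \sum_(i in S) a 0 i -> (2 <= #|S|)%N.
Proof.
move=> a1; apply: contraTT; rewrite -leqNgt -leNgt => S1.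
apply: (@le_trans _ _ (\sum_(i in S) 1)); first by rewrite ler_sum.
by rewrite sumr_const -[leRHS]/(1%:R) ler_nat.
Qed.

(** Since weights are at most 1, both [S] and its complement have at least two elements, so [S]
    defines a wall. The connected set [D] does not cross it, and the inequality passes to the
    closure. *)
Lemma heavy_on_chamber (D : set 'rV[R]_n) b S : is_weight_chamber D -> D b ->
  1 < \sum_(i in S) b 0 i -> 1 < \sum_(i in ~: S) b 0 i ->
  forall a, closure D a -> 1 <= \sum_(i in S) a 0 i.
Proof.
move=> [c off Dc] Db bS bS'.
have Doff a : D a -> weight_domain_off_walls a.
  by rewrite Dc => /connected_component_sub.
have b1 i : b 0 i <= 1 by have [[/(_ i)/andP[]]] := Doff _ Db.
have S2 := heavy_card b1 bS; have S'2 := heavy_card b1 bS'.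
have notwall a : D a -> \sum_(i in S) a 0 i != 1.
  move=> /Doff[_ nwall]; apply/eqP => aS; apply: nwall; exists S => //.
  by split=> //=; move: S'2; rewrite -(leq_add2l #|S|) cardsC card_ord.
have Dconn : connected D by rewrite Dc; exact: component_connected.
have cont := @weight_continuous S.
(* The strict and the weak inequality cut out the same part of [D], which is thus open and closed in
   [D]. *)
have /Dconn E : (D `&` [set a | 1 < \sum_(i in S) a 0 i]) !=set0 by exists b.
have Dheavy : D `<=` [set a | 1 <= \sum_(i in S) a 0 i].
  rewrite -E; first by move=> a [_ /ltW].
    exists [set a : 'rV[R]_n | 1 < \sum_(i in S) a 0 i] => //.
    by apply: (@open_comp _ _ _ [set x : R | 1 < x]); [move=> a _; exact: cont|exact: open_gt].
  exists [set a : 'rV[R]_n | 1 <= \sum_(i in S) a 0 i].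
    have /continuous_closedP H := cont; exact: (H _ (@closed_ge _ 1)).
  by apply/seteqP; split=> a [Da /= aS]; split => //=; rewrite ?(ltW aS)// lt_def aS notwall.
move=> a /(closureS Dheavy).
suff /closure_id <- : closed [set a : 'rV[R]_n | 1 <= \sum_(i in S) a 0 i] by [].
have /continuous_closedP H := cont; exact: (H _ (@closed_ge _ 1)).
Qed.

Lemma affine_hull_weight (X : set 'rV[R]_n) S (r : R) :
  (forall x, X x -> \sum_(i in S) x 0 i = r) ->
  forall x, affine_hull X x -> \sum_(i in S) x 0 i = r.
Proof.
move=> XS x [k [y [w [Xy w1 ->]]]].
under eq_bigr do rewrite summxE.
rewrite exchange_big /= (eq_bigr (fun j => w j * r)).
  by rewrite -mulr_suml w1 mul1r.
by move=> j _; rewrite -(XS _ (Xy j)) mulr_sumr; apply: eq_bigr => i _; rewrite mxE.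
Qed.

(** Both weight forms vanish on the direction space [V]. Adjoining a basis vector with index in [S],
    then one with index outside [S], raises the dimension twice. *)
Lemma affine_dim_two_weights (X : set 'rV[R]_n) (d : nat) S (r s : R) :
  affine_dim X d -> S != finset.set0 -> ~: S != finset.set0 ->
  (forall x, X x -> \sum_(i in S) x 0 i = r) ->
  (forall x, X x -> \sum_(i in ~: S) x 0 i = s) -> (d.+2 <= n)%N.
Proof.
move=> [x0 [V [<- hullE]]] /set0Pn[i iS] /set0Pn[j jS] XS XS'.
have V0 (T : {set 'I_n}) (t : R) : (forall x, X x -> \sum_(i in T) x 0 i = t) ->
    forall v, v \in V -> \sum_(i in T) v 0 i = 0.
  move=> XT v vV; have H := affine_hull_weight XT; rewrite hullE in H.
  have e1 : \sum_(i in T) x0 0 i = t.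
    by apply: H; exists 0; rewrite ?addr0//; exact: mem0v.
  have : \sum_(i in T) (x0 + v) 0 i = t by apply: H; exists v.
  under eq_bigr do rewrite mxE.
  by rewrite big_split /= e1 => /eqP; rewrite addrC -subr_eq0 addrK => /eqP.
have S0 := V0 _ _ XS.
have S'0 := V0 _ _ XS'.
pose e (k : 'I_n) : 'rV[R]_n := delta_mx 0 k.
have dW k (T : {set 'I_n}) : \sum_(l in T) e k 0 l = (k \in T)%:R.
  case: (boolP (k \in T)) => kT; last first.
    by rewrite big1// => l lT; rewrite /e mxE eqxx /=; case: eqP => // lk; rewrite -lk lT in kT.
  rewrite (bigD1 k)//= mxE !eqxx big1 ?addr0// => l /andP[_ lk].
  by rewrite mxE (negPf lk) andbF.
have step (U : {vspace 'rV[R]_n}) k : e k \notin U -> (\dim U < \dim (U + <[e k]>)%VS)%N.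
  move=> kU; have [le eq] := dimv_leqif_sup (addvSl U <[e k]>%VS).
  rewrite ltn_neqAle le andbT eq; apply: contra kU => /subvP; apply.
  by apply: (subvP (addvSr U _)); exact: memv_line.
apply: (@leq_trans (\dim (V + <[e i]> + <[e j]>)%VS)); last first.
  by apply: leq_trans (dimvS (subvf _)) _; rewrite dimvf /dim /= mul1n.
apply: (@leq_ltn_trans (\dim (V + <[e i]>)%VS)); apply: step.
  apply/negP => /S0; rewrite dW iS => /eqP; rewrite oner_eq0//.
apply/negP => /memv_addP[v vV [w /vlineP[c ->] E]].
move: (congr1 (fun v => \sum_(i in ~: S) (v : 'rV[R]_n) 0 i) E) => /=.
rewrite dW jS (eq_bigr (fun l => v 0 l + c * e i 0 l)); last by move=> l _; rewrite !mxE.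
rewrite big_split /= S'0// -mulr_sumr dW inE iS mulr0 addr0 => /eqP.
by rewrite oner_eq0.
Qed.

(* If some B-stable curve were reducible, a leaf would give a set [S] with
   [S]-weight and complementary weight at least 1 on all of the chamber, hence
   both equal to 1 as the total is 2 there: the chamber would lie in a wall. *)
Lemma chamber_stable_irreducible (K : fieldType) (omega : {set {set {set 'I_n}}})
    (D : set 'rV[R]_n) b (C : curve K n) :
  chamber R omega `<=` hypersimplex R n -> affine_dim (chamber R omega) n.-1 ->
  is_weight_chamber D -> chamber R omega `<=` closure D -> D b ->
  stable b C -> ncomp C = 1.
Proof.
move=> inner dimo chD oD Db stC; have [//|/eqP C1] := eqVneq (ncomp C) 1.
have [S [bS bS']] := stable_heavy_split stC C1.
have wS := heavy_on_chamber chD Db bS bS'.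
have wS' : forall a, closure D a -> 1 <= \sum_(i in ~: S) a 0 i.
  by apply: heavy_on_chamber chD Db bS' _; rewrite finset.setCK.
have both x : chamber R omega x -> \sum_(i in S) x 0 i = 1 /\ \sum_(i in ~: S) x 0 i = 1.
  move=> ox; have [_ tot] := inner _ ox.
  have : \sum_i x 0 i = \sum_(i in S) x 0 i + \sum_(i in ~: S) x 0 i.
    rewrite (bigID (mem S) predT)/=; congr (_ + _).
    by apply: eq_bigl => i; rewrite inE.
  move: (wS _ (oD _ ox)) (wS' _ (oD _ ox)); rewrite tot => ? ? ?.
  by split; lra.
have neq0 (T : {set 'I_n}) : 1 < \sum_(i in T) b 0 i -> T != finset.set0.
  by apply: contraTneq => ->; rewrite big_set0 -leNgt ler01.
have := affine_dim_two_weights dimo (neq0 _ bS) (neq0 _ bS')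
  (fun x ox => (both x ox).1) (fun x ox => (both x ox).2).
by move=> H; have := leq_trans H (leqSpred n); rewrite ltnn.
Qed.

End WeightChambers.

(** * Smoothing a stable curve *)

Section MatrixContinuity.
Variables (K : numFieldType) (T : topologicalType).
Local Open Scope classical_set_scope.

Definition mx_continuous m n (F : T -> 'M[K]_(m, n)) : Prop :=
  forall i j, continuous (fun t => F t i j).

Lemma mx_continuous_cst m n (A : 'M[K]_(m, n)) : mx_continuous (fun=> A).
Proof. by move=> i j; exact: cst_continuous. Qed.

Lemma mx_continuous_mul m (F : T -> 'M[K]_(m, 2)) (G : T -> 'M[K]_2) :
  mx_continuous F -> mx_continuous G -> mx_continuous (fun t => F t *m G t).
Proof.
move=> Fc Gc i j; rewrite (_ : (fun t => _) =
    (fun t => F t i 0 * G t 0 j + F t i 1 * G t 1 j)).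
  by move=> t; exact: (cvgD (cvgM (Fc i 0 t) (Gc 0 j t)) (cvgM (Fc i 1 t) (Gc 1 j t))).
apply/funext => t; rewrite mxE !big_ord_recl big_ord0 addr0.
by congr (_ + F t i _ * G t _ j); exact: val_inj.
Qed.

Lemma det2_continuous (F G : T -> 'rV[K]_2) :
  mx_continuous F -> mx_continuous G -> continuous (fun t => det2 (F t) (G t)).
Proof.
move=> Fc Gc; rewrite (_ : (fun t => _) =
    (fun t => F t 0 0 * G t 0 1 - F t 0 1 * G t 0 0)).
  by move=> t; exact: (cvgB (cvgM (Fc 0 0 t) (Gc 0 1 t)) (cvgM (Fc 0 1 t) (Gc 0 0 t))).
by apply/funext => t; rewrite det2E.
Qed.

Lemma open_neq0 : open [set x : K | x != 0].
Proof.
rewrite (_ : [set x | _] = ~` [set 0]); last first.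
  by apply/seteqP; split=> x /=; move/eqP.
apply: closed_openC; apply: accessible_closed_set1.
exact/hausdorff_accessible/norm_hausdorff.
Qed.

(** Stated over a general parameter space, to serve both for one-parameter smoothings and for the
    space of frames. *)
Lemma near_cross_ratio (I : Type) (Y : I -> T -> 'rV[K]_2) (x : T) (O : set K) i j k l :
  (forall i, mx_continuous (Y i)) -> open O ->
  det2 (Y i x) (Y l x) * det2 (Y j x) (Y k x) != 0 ->
  O (cross_ratio (Y^~ x) i j k l) ->
  \forall t \near x, det2 (Y i t) (Y l t) * det2 (Y j t) (Y k t) != 0 /\
    O (cross_ratio (Y^~ t) i j k l).
Proof.
move=> Yc oO den0 Ox.
have dc a b := det2_continuous (Yc a) (Yc b).
pose den t := det2 (Y i t) (Y l t) * det2 (Y j t) (Y k t).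
pose num t := det2 (Y i t) (Y k t) * det2 (Y j t) (Y l t).
have denc : {for x, continuous den} by exact: continuousM (dc i l x) (dc j k x).
have numc : {for x, continuous num} by exact: continuousM (dc i k x) (dc j l x).
have crc : {for x, continuous (fun t => num t / den t)}.
  by apply: (@continuousM _ _ num (fun t => (den t)^-1)) => //; exact: continuousV.
have near_den : nbhs x (den @^-1` [set y | y != 0]).
  by apply: denc; apply: open_nbhs_nbhs; split; [exact: open_neq0|exact: den0].
have near_cr : nbhs x ((fun t => num t / den t) @^-1` O).
  by apply: crc; apply: open_nbhs_nbhs; split; [exact: oO|exact: Ox].
by apply: filterS2 near_den near_cr => t; split.
Qed.

End MatrixContinuity.

Section Smoothing.
Variables (K : numFieldType) (n : nat) (C : curve K n).
Hypothesis gC : genus0_nodal C.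
Notation V := 'I_(ncomp C).
Implicit Types (u v w : V) (t : K).

Variables (r : V) (par : V -> V) (depth : V -> nat).
Hypothesis rooted : rooting (adj C) r par depth.
Variable dual : V -> V -> 'rV[K]_2.
Hypothesis dualE : forall v w, adj C v w -> det2 (node C v w) (dual v w) = 1.

(* In coordinates adapted to the node this is [(x, y) |-> (x, t y)], so that the
   image of a fixed point of [v] off the node tends to the node of [w]. *)
Definition glue v w t : 'M[K]_2 :=
  rank_one (node C v w) (node C w v) + t *: rank_one (dual v w) (dual w v).

Let adjC v w : adj C v w -> adj C w v.
Proof. by rewrite (genus0_sym gC). Qed.

Lemma mul_glue y v w t :
  y *m glue v w t = det2 (node C v w) y *: node C w v
                  + (t * det2 (dual v w) y) *: dual w v.
Proof. by rewrite mulmxDr -scalemxAr !mul_rank_one scalerA. Qed.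

(** For [t != 0] the gluings in the two directions of an edge are thus projectively inverse, while
    at [t = 0] both degenerate. *)
Lemma glueK v w t : adj C v w -> glue v w t *m glue w v t = (- t)%:M.
Proof.
move=> vw; apply: eq_mulmx_rows => y; rewrite mulmxA !mul_glue mul_mx_scalar.
have wv := adjC vw.
set p := node C v w; set q := node C w v; set p' := dual v w; set q' := dual w v.
have pp' : det2 p p' = 1 by exact: dualE.
have qq' : det2 q q' = 1 by exact: dualE.
have bil a b z : det2 z (a *: q + b *: q') = a * det2 z q + b * det2 z q'.
  by rewrite !det2E !mxE; ring.
rewrite !bil !det2_diag qq' (det2C q') qq'.
have cramer := det2_cramer p p' y; rewrite pp' scale1r in cramer.
rewrite [in RHS]cramer (det2C p' y) scalerDr !scalerA.
by congr (_ *: _ + _ *: _); ring.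
Qed.

Lemma glue_unit v w t : adj C v w -> t != 0 -> glue v w t \in unitmx.
Proof.
move=> vw t0; have := congr1 determinant (glueK t vw).
rewrite det_mulmx det_scalar => E; rewrite unitmxE unitfE.
apply: contraTneq isT => g0; move: E; rewrite g0 mul0r => /esym/eqP.
by rewrite expf_eq0 oppr_eq0 (negPf t0).
Qed.

Lemma glue_continuous v w : mx_continuous (glue v w).
Proof.
move=> i j; rewrite (_ : (fun t => _) = (fun t =>
    rank_one (node C v w) (node C w v) i j + t * rank_one (dual v w) (dual w v) i j)).
  move=> t; have Ft : Filter (nbhs t) by exact: nbhs_filter.
  exact: (cvgD (cvg_cst _) (cvgM cvg_id (cvg_cst _))).
by apply/funext => t; rewrite /glue mxE [X in _ + X]mxE.
Qed.

Fixpoint potential_rec k v t : 'M[K]_2 :=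
  if k is k'.+1 then glue v (par v) t *m potential_rec k' (par v) t else 1%:M.

(** The change of coordinates from the component [v] to the root, along the tree; the depth is
    exactly the number of steps needed. *)
Definition potential v t := potential_rec (depth v) v t.

Lemma potential_unit v t : t != 0 -> potential v t \in unitmx.
Proof.
move=> t0; rewrite /potential; move dv : (depth v) => k; elim: k v dv => [|k IH] v dv /=.
  exact: unitmx1.
have vr : v != r by apply: contra_eqN dv => /eqP ->; rewrite (depth_root rooted).
rewrite unitmx_mul glue_unit ?(edge_par rooted)//= IH//.
by apply: succn_inj; rewrite -(depth_par rooted).
Qed.

Lemma potential_edge v w t : adj C v w -> t != 0 ->
  exists2 s, s != 0 & potential v t = s *: (glue v w t *m potential w t).
Proof.
move=> vw t0; have step v' : v' != r -> potential v' t = glue v' (par v') t *m potential (par v') t.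
  by move=> v'r; rewrite /potential (depth_par rooted v'r).
have [[vr wE]|[wr vE]] := par_edge rooted vw.
  by exists 1; rewrite ?oner_neq0// scale1r wE step.
exists (- t)^-1; first by rewrite invr_eq0 oppr_eq0.
rewrite (step w wr) -vE mulmxA glueK// mul_scalar_mx scalerA mulVf ?scale1r//.
by rewrite oppr_eq0.
Qed.

(** Up to a scalar, the quotient of the potentials at the two ends of a path, written without
    inverses so that it extends continuously to [t = 0]. *)
Fixpoint transport a (q : seq V) t : 'M[K]_2 :=
  if q is b :: q' then glue a b t *m transport b q' t else 1%:M.

Lemma transport_continuous a q : mx_continuous (transport a q).
Proof.
elim: q a => [|b q IH] a /=; first exact: mx_continuous_cst.
exact: (@mx_continuous_mul K K 2 (glue a b) (transport b q) (@glue_continuous a b) (IH b)).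
Qed.

Lemma potential_transport a q t : path (adj C) a q -> t != 0 ->
  exists2 s, s != 0 & potential a t = s *: (transport a q t *m potential (last a q) t).
Proof.
move=> + t0; elim: q a => [|b q IH] a /=.
  by exists 1; rewrite ?oner_neq0// mul1mx scale1r.
move=> /andP[/potential_edge/(_ t0)[s s0 ->] /IH[s' s'0 ->]].
exists (s * s'); first by rewrite mulf_neq0.
by rewrite -mulmxA -scalemxAr scalerA.
Qed.

(** At [t = 0] each gluing sends every point off the node to the node of the next component. On a
    path without repetitions the entry and exit nodes of a component differ, so the product does not
    vanish and ends at the node by which the path enters [u]. *)
Lemma transport_limit q a b y : path (adj C) a (b :: q) -> uniq (a :: b :: q) ->
  det2 (node C a b) y != 0 ->
  let u := last b q in
  exists w c, [/\ c != 0, adj C u w, w != u, connect (off_edge u) a w &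
                  y *m transport a (b :: q) 0 = c *: node C u w].
Proof.
have [_ _ _ [_ node_neq] _] := gC; have [_ _ _ [node0 _] _] := gC.
elim: q a b y => [|c q IH] a b y.
  rewrite /= andbT inE => ab /andP[anb _] aby; exists a, (det2 (node C a b) y).
  split; [exact: aby|exact: adjC|exact: anb|exact: connect0|].
  by rewrite mulmx1 mul_glue mul0r scale0r addr0.
move=> /= /and3P[ab bc cq] /andP[abcq bcq] aby.
have abu : a != last c q by apply: contraNneq abcq => ->; rewrite inE mem_last orbT.
have bbu : b != last c q by move/andP: bcq => [+ _]; apply: contraNneq => {1}->; rewrite mem_last.
have ac : a != c by move: abcq; rewrite !inE !negb_or => /and3P[].
have ba := adjC ab.
have [||//|w [s [s0 uw wu con E]]] := IH b c (node C b a).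
- by rewrite /= bc.
- exact: bcq.
- rewrite -same_pointE ?node0//; apply: node_neq => //; by rewrite eq_sym.
exists w, (det2 (node C a b) y * s); split; [by rewrite mulf_neq0|exact: uw|exact: wu| |].
  by apply: connect_trans con; apply: connect1; rewrite /off_edge /= ab abu.
rewrite [LHS](mulmxA y (glue a b 0) (transport b (c :: q) 0)).
by rewrite mul_glue mul0r scale0r addr0 -scalemxAl E scalerA.
Qed.

Definition smoothing t (i : 'I_n) : 'rV[K]_2 := mark C i *m potential (cpt C i) t.

(** [Y] transports the mark along a path to [u], so it stays meaningful at [t = 0], where the
    potentials cannot be inverted in general. *)
Lemma smoothing_limit u i : exists Y : K -> 'rV[K]_2, [/\ mx_continuous Y,
  exists2 c, c != 0 & Y 0 = c *: retract u i &
  forall t, t != 0 -> exists2 s, s != 0 &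
    smoothing t i *m invmx (potential u t) = s *: Y t].
Proof.
have [_ [_ conn] _ _ [mark0 mark_node]] := gC; have [_ _ _ [node0 _] _] := gC.
have /connectP[q0 q0p] := conn (cpt C i) u.
case/shortenP: q0p => q qp uq _ ->.
exists (fun t => mark C i *m transport (cpt C i) q t); split.
- exact: (@mx_continuous_mul K K 1 (fun=> mark C i) (transport (cpt C i) q)
    (@mx_continuous_cst _ _ _ _ _) (@transport_continuous _ _)).
- have retr p : retracts_to (last (cpt C i) q) i p -> p != 0 ->
      exists2 c, c != 0 & p = c *: retract (last (cpt C i) q) i.
    by move=> /(retracts_toP gC) /same_point_scale; apply.
  case: q qp uq retr => [|b q] qp uq retr.
    rewrite /= mulmx1; apply: retr; last exact: mark0.
    by left; split => //; apply/same_pointP.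
  have [|w [c [c0 uw wu con ->]]] := @transport_limit q (cpt C i) b (mark C i) qp uq.
    have := mark_node i b; move/andP: (qp) => [-> _] /(_ isT).
    by rewrite same_point_sym same_pointE// node0//; move/andP: qp => [].
  have [||d d0 ->] := retr (node C (last b q) w).
  - right; exists w; split => //; last exact/same_pointP.
    have off_sym : symmetric (off_edge (last b q)).
      by move=> x y; rewrite /off_edge /= (genus0_sym gC) [(y != _) && _]andbC.
    by rewrite (sym_connect_sym off_sym).
  - exact: node0.
  - by exists (c * d); rewrite ?mulf_neq0// scalerA.
- move=> t t0; have [s s0 E] := potential_transport qp t0; exists s => //.
  by rewrite /smoothing E -!scalemxAr -scalemxAl mulmxA mulmxK// potential_unit.
Qed.

End Smoothing.

(** * Density of the main stratum *)

Section Lines.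
Variables (K : fieldType) (n : nat).
Implicit Types (C D : curve K n) (M : 'M[K]_(2, n)).

Definition column M (i : 'I_n) : 'rV[K]_2 := (col i M)^T.

Lemma pluecker_det2 M i j : pluecker M i j = det2 (column M i) (column M j).
Proof.
rewrite /pluecker /det2 -[LHS]det_tr; congr (\det _).
by have H := tr_row_mx (col i M) (col j M); exact: H.
Qed.

Lemma ncomp1_eq C (u v : 'I_(ncomp C)) : ncomp C = 1 -> u = v.
Proof.
by case: u v => [u ul] [v vl] C1; apply: val_inj; move: ul vl; rewrite /= C1; case: u; case: v.
Qed.

Lemma line_iso C D g : genus0_nodal C -> genus0_nodal D ->
  ncomp C = 1 -> ncomp D = 1 -> g \in unitmx ->
  (forall i, same_point (mark C i *m g) (mark D i)) -> curve_iso C D.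
Proof.
move=> gC gD C1 D1 gU CD.
have [[_ irrC] [C0 _] _ _ _] := gC; have [[_ irrD] [D0 _] _ _ _] := gD.
have adj0 u v : adj C u v = false by rewrite (ncomp1_eq u v C1) (negPf (irrC v)).
exists (fun=> Ordinal D0), (fun=> g); split => //.
- by exists (fun=> Ordinal C0) => u; exact: ncomp1_eq.
- by move=> u v; rewrite adj0 (negPf (irrD _)).
- by move=> u v; rewrite adj0.
- by move=> i; split; [exact: ncomp1_eq|exact: CD].
Qed.

Definition line_curve (d : 'I_n -> 'rV[K]_2) : curve K n :=
  @Curve K n 1 (fun _ _ => false) (fun _ _ => 0) (fun=> ord0) d.

Lemma line_curve_stable (R : realType) (d : 'I_n -> 'rV[K]_2) : (2 < n)%N ->
  (forall i j, i != j -> det2 (d i) (d j) != 0) ->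
  stable (const_mx 1 : 'rV[R]_n) (line_curve d).
Proof.
move=> n2 dd; have d0 i : d i != 0.
  have [j ij] : exists j, i != j.
    have n0 : (0 < n)%N by exact: leq_trans n2.
    have n1 : (1 < n)%N by exact: leq_trans n2.
    have [i0|i0] := eqVneq (val i) 0; [exists (Ordinal n1)|exists (Ordinal n0)] => //.
    by apply/eqP => /(congr1 val); rewrite i0.
  exact: det2_neq0l (dd _ _ ij).
split.
- split=> //=.
  + by split=> // u v; rewrite !ord1 connect0.
  + by apply/eqP; rewrite cards_eq0; apply/eqP/setP => e; rewrite !inE.
- move=> u; rewrite /log_degree (eq_card0 (A := adj (line_curve d) u)) //.
  rewrite (eq_bigl predT); last by move=> i; rewrite (ord1 u).
  rewrite (eq_bigr (fun=> 1)); last by move=> i _; rewrite mxE.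
  by rewrite sumr_const card_ord sub0r addrC subr_gt0 ltr_nat.
- move=> I same; rewrite (eq_bigr (fun=> 1)); last by move=> i _; rewrite mxE.
  rewrite sumr_const -[leRHS]/(1%:R) ler_nat leqNgt; apply/negP => /card_gt1P[i [j [iI jI ij]]].
  have [_] := same _ _ iI jI; rewrite /= same_pointE// => /eqP ij0.
  by have := dd _ _ ij; rewrite ij0 eqxx.
Qed.

Lemma main_stratum_frame M : (1 < n)%N ->
  (forall i j, i != j -> det2 (column M i) (column M j) != 0) ->
  \rank M = 2 /\ pluecker_support M = main_support n.
Proof.
move=> n1 Mij; split.
  apply/eqP; rewrite eqn_leq rank_leq_row /=.
  have n0 : (0 < n)%N by exact: ltnW.
  have := Mij (Ordinal n0) (Ordinal n1) isT.
  rewrite -pluecker_det2 /pluecker !colE -mul_mx_row; set N := row_mx _ _ => det0.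
  apply: leq_trans (mxrankM_maxl M N).
  by rewrite (@mxrank_unit K 2 (M *m N))// unitmxE unitfE.
apply/setP => I; rewrite !inE; apply/idP/idP.
  move=> /existsP[i /existsP[j /andP[/eqP -> Mn]]]; rewrite cards2.
  by have [ij|//] := eqVneq i j; rewrite ij pluecker_det2 det2_diag eqxx in Mn.
move=> /cards2P[i [j [ij ->]]]; apply/existsP; exists i; apply/existsP; exists j.
by rewrite eqxx pluecker_det2 Mij.
Qed.

End Lines.

(** * Topology of the space of stable curves *)

Section StableCurveTopology.
Variables (K : numFieldType) (R : realType) (n : nat) (a : 'rV[R]_n).
Local Open Scope classical_set_scope.

Definition stable_curve_of (C : curve K n) (sC : stable a C) : stable_curve K a :=
  exist (fun D => D \in [set D : curve K n | stable a D]) C (mem_set sC).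

Lemma cross_ratio_in_open i j k l (O : set K) : uniq [:: i; j; k; l] -> open O ->
  open (@cross_ratio_in K R n a (i, j, k, l) O).
Proof.
move=> u oO; set B := cross_ratio_in _ _.
exists [set B]; last first.
  by rewrite predeqE => ?; split=> [[_ ->]|] //; exists B.
move=> _ ->; exists [fset B]%fset.
  by move=> X; rewrite in_fset1 => /eqP ->; apply: mem_set; exists i, j, k, l, O.
rewrite predeqE => X; split=> [H|XB Y]; last by rewrite /= in_fset1 => /eqP ->.
by apply: (H B); rewrite /= in_fset1.
Qed.

(** Basic neighbourhoods are finite intersections of cross-ratio conditions, so convergence may be
    tested on single conditions. *)
Lemma cvg_stable_curve (F : set_system (stable_curve K a)) (C : stable_curve K a) :
  Filter F ->
  (forall i j k l (O : set K), uniq [:: i; j; k; l] -> open O ->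
     cross_ratio_in (i, j, k, l) O C -> F (cross_ratio_in (i, j, k, l) O)) ->
  F --> C.
Proof.
move=> FF FC A /=; rewrite nbhsE => -[_ [[B sB <-] [D BD Dt] sUBA]].
rewrite nbhs_filterE; apply: filterS sUBA _; apply: (@filterS _ _ _ D).
  by move=> ? ?; exists D.
have /sB [E sE IED] := BD; rewrite -IED; apply: filter_bigI => U EU.
have /sE/set_mem [i [j [k [l [P [uq oP UE]]]]]] := EU.
have CU : U C by move: Dt; rewrite -IED => /(_ _ EU).
by move: CU; rewrite /= UE; exact: FC.
Qed.

End StableCurveTopology.

Section Density.
Variables (K : numFieldType) (R : realType) (n : nat).
Local Open Scope classical_set_scope.

(* [x t] gives the marked points on a line smoothing [C]; [Y u t] is [x t] in a
   coordinate in which it tends to the retractions onto the component [u]. *)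
Lemma exists_smoothing (C : curve K n) : genus0_nodal C ->
  exists x : K -> 'I_n -> 'rV[K]_2, forall u : 'I_(ncomp C),
  exists Y : 'I_n -> K -> 'rV[K]_2, [/\
    forall i, mx_continuous (Y i),
    exists2 c : 'I_n -> K, (forall i, c i != 0) & forall i, Y i 0 = c i *: retract u i &
    forall t, t != 0 -> exists g (s : 'I_n -> K), [/\ g \in unitmx,
      forall i, s i != 0 & forall i, x t i *m g = s i *: Y i t]].
Proof.
move=> gC; have [_ [m0 conn] _ [node0 _] _] := gC.
have [par [depth rooted]] := tree_rooting (genus0_sym gC) conn (genus0_card gC) (Ordinal m0).
have /choice[f fE] : forall e : 'I_(ncomp C) * 'I_(ncomp C), exists q,
    adj C e.1 e.2 -> det2 (node C e.1 e.2) q = 1.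
  move=> [v w] /=; case: (boolP (adj C v w)) => vw; last by exists 0.
  by have [q] := det2_dual (node0 _ _ vw); exists q.
have dualE v w (vw : adj C v w) := fE (v, w) vw.
pose pot := potential par depth (fun v w => f (v, w)).
exists (smoothing par depth (fun v w => f (v, w))) => u.
have /choice[Y YE] := smoothing_limit gC rooted dualE u; exists Y; split.
- by move=> i; have [] := YE i.
- have /choice[c cE] : forall i, exists c, c != 0 /\ Y i 0 = c *: retract u i.
    by move=> i; have [_ [c c0 E] _] := YE i; exists c.
  by exists c => i; have [] := cE i.
- move=> t t0; exists (invmx (pot u t)).
  have /choice[s sE] : forall i, exists s, s != 0 /\
      smoothing par depth (fun v w => f (v, w)) t i *m invmx (pot u t) = s *: Y i t.
    by move=> i; have [_ _ /(_ t t0)[s s0 sE]] := YE i; exists s.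
  exists s; split=> [|i|i]; try by have [] := sE i.
  by rewrite unitmx_inv; exact: (potential_unit gC rooted dualE).
Qed.

(** A mark is never at a node, and with all weights equal to 1 no two marks coincide; so the
    component carrying a mark separates it from every other one. *)
Lemma retract_distinct (C : curve K n) i j : stable (const_mx 1 : 'rV[R]_n) C -> i != j ->
  det2 (retract (cpt C i) i) (retract (cpt C i) j) != 0.
Proof.
move=> [gC _ coincide] ij.
have [_ _ _ _ [mark0 mark_node]] := gC.
rewrite -same_pointE ?retract_neq0//.
have -> : retract (cpt C i) i = mark C i by rewrite /retract eqxx.
have [[ji ->]|[w [iw _ ->]]] := retract_cases (cpt C i) j gC; last exact: mark_node.
apply/negP => mij; have := coincide [set i; j]%SET.
suff H : forall a b, a \in [set i; j]%SET -> b \in [set i; j]%SET ->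
    cpt C a = cpt C b /\ same_point (mark C a) (mark C b).
  move=> /(_ H); rewrite (eq_bigr (fun=> 1)); last by move=> l _; rewrite mxE.
  by rewrite sumr_const cards2 ij -[leRHS]/(1%:R) ler_nat.
have mji : same_point (mark C j) (mark C i) by rewrite same_point_sym.
by move=> a b; rewrite !inE => /orP[]/eqP-> /orP[]/eqP->; split=> //; apply/same_pointP.
Qed.

Lemma main_stratum_dense (C : stable_curve K (const_mx 1 : 'rV[R]_n)) U :
  nbhs C U -> exists (M : frame K [set main_support n]%SET) C',
    U C' /\ line_marked_by (val C') (val M).
Proof.
move=> CU; have stC := set_valP C; have [gC pos _] := stC.
(* The degrees of the components are positive and add up to [n - 2]. *)
have n2 : (2 < n)%N.
  have := sum_log_degrees (const_mx 1 : 'rV[R]_n) gC.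
  rewrite [in RHS](eq_bigr (fun=> 1)) => [|i _]; last by rewrite mxE.
  rewrite sumr_const card_ord => E; rewrite -(ltr_nat R) -subr_gt0 -E.
  have [_ [m0 _] _ _ _] := gC.
  rewrite (bigD1 (Ordinal m0))//= ltr_pwDl// sumr_ge0// => v _; exact: ltW.
have [x limit] := exists_smoothing gC.
pose good t := t != 0 /\ forall i j, i != j -> det2 (x t i) (x t j) != 0.
have near_neq0 : \forall t \near (0 : K)^', t != 0 by exact: nbhs_dnbhs_neq.
have near_distinct : \forall t \near (0 : K)^', forall i j, i != j -> det2 (x t i) (x t j) != 0.
  apply: filter_forall => i; apply: filter_forall => j.
  have [<-|ij] := eqVneq i j; first exact: nearW.
  (* In the coordinate of the component carrying the [i]-th mark, the two points have distinct
     limits. *)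
  have [Y [Yc [c c0 Y0] YE]] := limit (cpt (val C) i).
  have dc := det2_continuous (Yc i) (Yc j).
  have Yij0 : det2 (Y i 0) (Y j 0) != 0.
    by rewrite !Y0 det2Z !mulf_neq0// (retract_distinct stC ij).
  have near_Y : \forall t \near (0 : K)^', det2 (Y i t) (Y j t) != 0.
    apply: nbhs_dnbhs; apply: (dc 0 [set y | y != 0]).
    by apply: open_nbhs_nbhs; split; [exact: open_neq0|exact: Yij0].
  apply: filterS2 near_neq0 near_Y => t t0 Yij _.
  have [g [s [gU s0 xE]]] := YE t t0.
  have := det2_mulmx (x t i) (x t j) g; rewrite !xE det2Z => E.
  apply: contraTneq isT => x0; move: E; rewrite x0 mul0r => /eqP.
  by rewrite !mulf_eq0 (negPf Yij) !(negPf (s0 _)).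
have near_good : \forall t \near (0 : K)^', good t by apply: filterS2 near_neq0 near_distinct.
have Cx_stable t : good t -> stable (const_mx 1 : 'rV[R]_n) (line_curve (x t)).
  by move=> [_]; exact: line_curve_stable.
(* The value [C] is a filler at the bad [t], including [t = 0]; all [t] near 0 and different from it
   are good. *)
pose Cx t : stable_curve K (const_mx 1 : 'rV[R]_n) :=
  if pselect (good t) is left gt then stable_curve_of (Cx_stable t gt) else C.
have CxE t : good t -> val (Cx t) = line_curve (x t).
  by rewrite /Cx; case: pselect.
have cvgCx : Cx @ (0 : K)^' --> C.
  apply: cvg_stable_curve => i j k l O uijkl oO [u [den0 Ou]].
  (* The family is read in the coordinate of the component [u] on which the cross-ratio of [C] is
     computed. *)
  have [Y [Yc [c c0 Y0] YE]] := limit u.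
  have Y01 i' : Y i' 0 *m 1%:M = c i' *: retract u i' by rewrite mulmx1.
  have [den0' crE] := cross_ratio_proj (unitmx1 _ _) c0 Y01 den0.
  have near0 : \forall t \near (0 : K), det2 (Y i t) (Y l t) * det2 (Y j t) (Y k t) != 0 /\
      O (cross_ratio (Y^~ t) i j k l).
    by apply: near_cross_ratio => //; rewrite crE.
  apply: filterS2 near_good (nbhs_dnbhs near0) => t gt [denY OY].
  have [g [s [gU s0 xE]]] := YE t gt.1.
  have [den_x cr_x] := cross_ratio_proj gU s0 xE denY.
  rewrite /= /cross_ratio_in CxE//; exists ord0.
  rewrite !ncomp1_retract//=; split => //.
  by move: OY; rewrite -cr_x.
have nearU : (0 : K)^' (Cx @^-1` U) by exact: cvgCx.
have [t [gt Ut]] := filter_ex (filterI near_good nearU).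
pose M := \matrix_(a < 2, i < n) x t i 0 a.
have colM i : column M i = x t i by apply/rowP => a; rewrite !mxE.
have [Mrk Msupp] : \rank M = 2 /\ pluecker_support M = main_support n.
  apply: main_stratum_frame; first exact: ltnW.
  by move=> i j ij; rewrite !colM gt.2.
have Mframe : M \in [set M : 'M[K]_(2, n) | \rank M = 2 /\
    pluecker_support M \in [set main_support n]%SET].
  by apply: mem_set; split => //; rewrite Msupp inE.
exists (exist (fun M => M \in _) M Mframe), (Cx t); split => //.
by rewrite CxE //; split=> // i; rewrite -[(col i _)^T]/(column M i) colM.
Qed.

End Density.

(** * Limits of cross-ratios *)

Section TorusOrbits.
Variables (K : numFieldType) (n : nat) (omega : {set {set {set 'I_n}}}).
Implicit Types (M N : frame K omega).
Local Open Scope classical_set_scope.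
Local Open Scope quotient_scope.

Lemma parameters_classP M N :
  reflect (parameters_class M = parameters_class N) (same_orbit M N).
Proof. exact: eqmodP. Qed.

(** The torus rescales the columns, and a change of basis of the plane acts on all of them by one
    invertible matrix. *)
Lemma same_orbit_columns M N : same_orbit M N -> exists g (s : 'I_n -> K),
  [/\ g \in unitmx, forall i, s i != 0 &
      forall i, column (val M) i *m g = s i *: column (val N) i].
Proof.
move=> /asboolP[t [t0 /andP[_ /submxP[A NE]]]].
have [rkN _] := set_valP N.
exists A^T, (fun i => (t 0 i)^-1); split=> [|i|i]; last first.
- have -> : column (val N) i = t 0 i *: (column (val M) i *m A^T).
    apply/rowP => a; rewrite !mxE NE mulr_sumr mxE; apply: eq_bigr => b _.
    by rewrite mul_mx_diag !mxE; ring.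
  by rewrite scalerA mulVf// scale1r.
- by rewrite invr_eq0.
- rewrite unitmx_tr -row_free_unit /row_free eqn_leq rank_leq_row /= -[X in (X <= _)%N]rkN NE.
  exact: mxrankM_maxl.
Qed.

Lemma column_continuous i : mx_continuous (fun M => column (val M) i).
Proof.
move=> a b; rewrite (_ : (fun M => _) = (fun A : 'M[K]_(2, n) => A b i) \o val).
  move=> M; apply: continuous_comp; last exact: coord_continuous.
  exact: initial_continuous.
by apply/funext => M; rewrite /= !mxE.
Qed.

Definition frame_cross_ratio_in (i j k l : 'I_n) (O : set K) : set (frame K omega) :=
  [set M | det2 (column (val M) i) (column (val M) l) *
           det2 (column (val M) j) (column (val M) k) != 0 /\
           O (cross_ratio (column (val M)) i j k l)].

Lemma frame_cross_ratio_in_orbit i j k l O M N :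
  parameters_class M = parameters_class N ->
  frame_cross_ratio_in i j k l O M -> frame_cross_ratio_in i j k l O N.
Proof.
move=> /esym/parameters_classP/same_orbit_columns[g [s [gU s0 MN]]] [den OM].
have [denN crN] := cross_ratio_proj gU s0 MN den.
by split=> //; rewrite crN.
Qed.

(** The set of frames is a union of orbits, hence the full preimage of its image, so its openness
    descends to the quotient. *)
Lemma open_parameters_cross_ratio i j k l (O : set K) : open O ->
  open ((@parameters_class K n omega) @` frame_cross_ratio_in i j k l O).
Proof.
move=> oO; suff : open ((@parameters_class K n omega) @^-1`
    ((@parameters_class K n omega) @` frame_cross_ratio_in i j k l O)) by [].
rewrite (_ : _ @^-1` _ = frame_cross_ratio_in i j k l O).
  rewrite openE => M [den OM].
  exact: (near_cross_ratio column_continuous oO den OM).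
apply/seteqP; split=> M; last by move=> MO; exists M.
by move=> [N NO NM]; exact: frame_cross_ratio_in_orbit NM NO.
Qed.

End TorusOrbits.

Section Comparison.
Variables (K : numFieldType) (R : realType) (n : nat).
Variables (omega : {set {set {set 'I_n}}}).
Local Notation A := (const_mx 1 : 'rV[R]_n).
Variables (UF : topologicalType) (iota : main_parameters K n -> UF).
Variables (Phi : UF -> Mbar K A) (p : UF -> parameters K omega).
Hypothesis Phi_homeo : homeomorphism Phi.
Hypothesis Phi_main : natural_identification (Phi \o iota).
Hypothesis p_cont : continuous p.
Hypothesis p_id : extends_identity iota p.
Local Open Scope classical_set_scope.
Local Open Scope quotient_scope.

Lemma Mbar_classP (a : 'rV[R]_n) (C D : stable_curve K a) :
  curve_iso (val C) (val D) -> Mbar_class C = Mbar_class D.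
Proof. by move=> CD; apply/eqmodP/asboolP. Qed.

(* Both cross-ratios are limits of the cross-ratios of points of the main
   stratum tending to [z]. *)
Lemma cross_ratio_limit (z : UF) (C : stable_curve K A) (N : frame K omega)
    (u : 'I_(ncomp (val C))) (i j k l : 'I_n) :
  Phi z = Mbar_class C -> p z = parameters_class N -> uniq [:: i; j; k; l] ->
  det2 (retract u i) (retract u l) * det2 (retract u j) (retract u k) != 0 ->
  det2 (column (val N) i) (column (val N) l) *
    det2 (column (val N) j) (column (val N) k) != 0 ->
  cross_ratio (retract u) i j k l = cross_ratio (column (val N)) i j k l.
Proof.
move=> Phiz pz uijkl denC denN; apply/eqP; apply: contraT => neq.
have [Psi [PhiK PsiK _ Psi_cont]] := Phi_homeo.
have : hausdorff_space K by exact: norm_hausdorff.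
rewrite open_hausdorff => /(_ _ _ neq)[[P Q] /= [/set_mem Pc /set_mem Qc] [oP oQ /eqP PQ0]].
(* [h] is the projection [p] read on stable curves; its continuity turns the condition on the
   cross-ratios of frames into a neighbourhood of [C]. *)
pose h := p \o Psi \o @Mbar_class K R n A.
have h_cont : continuous h.
  move=> D; apply: (@continuous_comp _ _ _ (@Mbar_class K R n A) (p \o Psi)).
    exact: pi_continuous.
  by apply: continuous_comp; [exact: Psi_cont|exact: p_cont].
have hC : h C = parameters_class N by rewrite /h /= -Phiz PhiK pz.
pose W := (@parameters_class K n omega) @` frame_cross_ratio_in i j k l Q.
have CW : nbhs C (h @^-1` W).
  apply: h_cont; apply: open_nbhs_nbhs; split; first exact: open_parameters_cross_ratio.
  by rewrite hC; exists N.
have CP : nbhs C (cross_ratio_in (i, j, k, l) P).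
  apply: open_nbhs_nbhs; split; first exact: cross_ratio_in_open.
  by exists u.
have [M [C' [[C'W C'P] [C'1 C'M]]]] := main_stratum_dense (filterI CW CP).
have [D [D1 DM] PhiM] := Phi_main M.
(* [C'] and [D] are both the projective line marked by the columns of [M], hence isomorphic. *)
have hC' : h C' = p (iota (parameters_class M)).
  rewrite /h /=; congr p; rewrite -[RHS]PhiK; congr Psi; rewrite [RHS]PhiM.
  have [gC' _ _] := set_valP C'; have [gD _ _] := set_valP D.
  apply: Mbar_classP; apply: (line_iso gC' gD C'1 D1 (unitmx1 _ _)) => i'.
  by rewrite mulmx1 C'M DM; apply/same_pointP.
have [N' N'M pM] := p_id M.
have [N'' N''Q N''N'] := C'W.
have [_ N'Q] : frame_cross_ratio_in i j k l Q N'.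
  by apply: frame_cross_ratio_in_orbit N''Q; rewrite N''N' hC' pM.
have [u' [den' C'u']] := C'P.
have : (P `&` Q) (cross_ratio (column (val N')) i j k l).
  split => //; move: C'u'; rewrite !ncomp1_retract// !C'M -N'M.
  by [].
by rewrite PQ0.
Qed.

End Comparison.

(** * Equality of cross-ratios at their poles *)

Section FourthPoint.
Variables (K : fieldType) (I : eqType).
Implicit Types (d e : I -> 'rV[K]_2).

Lemma det2_both0 (p q y : 'rV[K]_2) : det2 p q != 0 -> y != 0 ->
  det2 p y = 0 -> det2 q y != 0.
Proof.
move=> pq y0 py; apply: contraNneq y0 => qy.
have := det2_cramer p q y; rewrite (det2C y) py qy oppr0 !scale0r addr0 => /eqP.
by rewrite scaler_eq0 (negPf pq).
Qed.

(* The cross-ratio equality with denominators cleared, so that it makes sense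
   also when [l] lies at the pole of one of the two cross-ratios. *)
Lemma cross_ratio_clear d e (i j k : I) :
  (forall l, d l != 0) -> (forall l, e l != 0) ->
  det2 (d i) (d j) != 0 -> det2 (d i) (d k) != 0 -> det2 (d j) (d k) != 0 ->
  det2 (e i) (e j) != 0 -> det2 (e i) (e k) != 0 -> det2 (e j) (e k) != 0 ->
  (forall i j k l, uniq [:: i; j; k; l] ->
     det2 (d i) (d l) * det2 (d j) (d k) != 0 ->
     det2 (e i) (e l) * det2 (e j) (e k) != 0 ->
     cross_ratio d i j k l = cross_ratio e i j k l) ->
  forall l, det2 (d i) (d k) * det2 (d j) (d l) * (det2 (e i) (e l) * det2 (e j) (e k)) =
     det2 (e i) (e k) * det2 (e j) (e l) * (det2 (d i) (d l) * det2 (d j) (d k)).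
Proof.
move=> d0 e0 dij dik djk eij eik ejk H l.
have diff a b : det2 (d a) (d b) != 0 -> a != b.
  by apply: contraNneq => ->; rewrite det2_diag.
have ij := diff _ _ dij; have ik := diff _ _ dik; have jk := diff _ _ djk.
have [->|il] := eqVneq i l; first by rewrite !det2_diag; ring.
have [->|jl] := eqVneq j l; first by rewrite !det2_diag; ring.
have [->|kl] := eqVneq k l; first by ring.
have clear a b c : uniq [:: a; b; c; l] ->
    det2 (d a) (d l) != 0 -> det2 (d b) (d c) != 0 ->
    det2 (e a) (e l) != 0 -> det2 (e b) (e c) != 0 ->
    det2 (d a) (d c) * det2 (d b) (d l) * (det2 (e a) (e l) * det2 (e b) (e c)) =
    det2 (e a) (e c) * det2 (e b) (e l) * (det2 (d a) (d l) * det2 (d b) (d c)).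
  move=> abcl dal dbc eal ebc; apply/eqP; rewrite -eqr_div ?mulf_neq0//.
  by apply/eqP/H; rewrite ?mulf_neq0.
have sym (p q : 'rV[K]_2) : det2 p q != 0 -> det2 q p != 0.
  by rewrite det2C oppr_eq0.
have dji := sym _ _ dij; have dki := sym _ _ dik.
have eji := sym _ _ eij; have eki := sym _ _ eik.
have ijkl : uniq [:: i; j; k; l].
  by rewrite /= !inE !negb_or ij ik il jk jl kl.
have jikl : uniq [:: j; i; k; l].
  by rewrite /= !inE !negb_or eq_sym ij ik il jk jl kl.
have kjil : uniq [:: k; j; i; l].
  by rewrite /= !inE !negb_or eq_sym jk eq_sym ik kl eq_sym ij jl il.
(* When [l] is at the pole [d i], moving the pole to [j] forces [e l] to be at [e i], unless [e l]
   is at [e j]; moving the pole to [k] excludes the latter. *)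
have [dil|dil] := eqVneq (det2 (d i) (d l)) 0.
- have djl := det2_both0 dij (d0 l) dil; have dkl := det2_both0 dik (d0 l) dil.
  have [ejl|ejl] := eqVneq (det2 (e j) (e l)) 0; last first.
    have := clear j i k jikl djl dik ejl eik; rewrite dil !(mulr0, mul0r) => /esym/eqP.
    rewrite !mulf_eq0 (negPf ejk) (negPf djl) (negPf dik) !orbF /= => /eqP ->.
    by rewrite !(mulr0, mul0r).
  have := clear k j i kjil dkl dji (det2_both0 ejk (e0 l) ejl) eji.
  rewrite ejl !(mulr0, mul0r) => /eqP.
  by rewrite !mulf_eq0 (negPf dki) (negPf djl) (negPf eji) (negPf (det2_both0 ejk (e0 l) ejl)).
(* The pole of the second cross-ratio alone is impossible, by the same two changes of pole. *)
have [eil|eil] := eqVneq (det2 (e i) (e l)) 0; last exact: clear.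
have ejl := det2_both0 eij (e0 l) eil; have ekl := det2_both0 eik (e0 l) eil.
have [djl|djl] := eqVneq (det2 (d j) (d l)) 0; last first.
  have := clear j i k jikl djl dik ejl eik; rewrite eil !(mulr0, mul0r) => /eqP.
  by rewrite !mulf_eq0 (negPf djk) (negPf dil) (negPf ejl) (negPf eik).
have := clear k j i kjil (det2_both0 djk (d0 l) djl) dji ekl eji.
rewrite djl !(mulr0, mul0r) => /esym/eqP.
by rewrite !mulf_eq0 (negPf eki) (negPf ejl) (negPf dji) (negPf (det2_both0 djk (d0 l) djl)).
Qed.

End FourthPoint.

(** [genmx] gives a canonical matrix for each line, so that coincidence of points becomes an
    equality defining the blocks of a partition. *)
Lemma stable_block_weight (K : fieldType) (R : realType) (n : nat) (b : 'rV[R]_n)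
    (C : curve K n) (d : 'I_n -> 'rV[K]_2) :
  stable b C -> ncomp C = 1 -> (forall i, same_point (d i) (mark C i)) ->
  forall i, \sum_(j | genmx (d j) == genmx (d i)) b 0 j <= 1.
Proof.
move=> [_ _ block] C1 dC i.
have H := block [set j | genmx (d j) == genmx (d i)]%SET.
rewrite (eq_bigl (fun j => j \in [set j | genmx (d j) == genmx (d i)]%SET)); last by move=> j; rewrite inE.
apply: H => j k; rewrite !inE => /eqP ji /eqP ki; split; first exact: ncomp1_eq.
apply: same_point_trans (dC k); rewrite same_point_sym; apply: same_point_trans (dC j).
by apply/genmxP; rewrite ji ki.
Qed.

(** * Equality of the projection and the reduction morphism *)

Local Open Scope classical_set_scope.

Theorem theorem15 (R : realType) (n : nat) (omega : {set {set {set 'I_n}}})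
  (* the chamber C_omega *)
  (omega_chamber : is_chamber R R[i] omega)
  (omega_inner : chamber R omega `<=` relative_interior (hypersimplex R n))
  (omega_dim : affine_dim (chamber R omega) n.-1)
  (* the chamber D_omega and the weights A, B *)
  (Domega : set 'rV[R]_n) (Domega_chamber : is_weight_chamber Domega)
  (omega_Domega : chamber R omega `<=` closure Domega)
  (A : 'rV[R]_n) (A1 : A = const_mx 1)
  (B : 'rV[R]_n) (BD : Domega B)
  (* the universal space of parameters, its subspace F_n, and its
     identification with the moduli space of A-stable curves *)
  (UF : topologicalType) (iota : main_parameters R[i] n -> UF)
  (Phi : UF -> Mbar R[i] A) (Phi_homeo : homeomorphism Phi)
  (Phi_main : natural_identification (Phi \o iota))
  (* the identification of F_omega with the moduli space of B-stable curves *)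
  (Psi : parameters R[i] omega -> Mbar R[i] B)
  (Psi_nat : natural_identification Psi)
  (* the projection p_omega *)
  (p : UF -> parameters R[i] omega) (p_cont : continuous p)
  (p_id : extends_identity iota p)
  (* the reduction morphism *)
  (rho : Mbar R[i] A -> Mbar R[i] B) (rho_red : reduction_morphism rho) :
  forall z : UF, Psi (p z) = rho (Phi z).
Proof.
move=> z; pose C := repr (Phi z); pose N := repr (p z).
have Phiz : Phi z = Mbar_class C by rewrite /Mbar_class reprK.
have pz : p z = parameters_class N by rewrite /parameters_class reprK.
have [D CD rhoC] := rho_red C; have [E [E1 EN] PsiN] := Psi_nat N.
have inner : chamber R omega `<=` hypersimplex R n by move=> x /omega_inner[].
have stD := set_valP D; have stE := set_valP E.
(* Irreducibility of [D] is what identifies it with one component of [C] carrying the retracted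
   marks. *)
have D1 := chamber_stable_irreducible inner omega_dim Domega_chamber omega_Domega BD stD.
subst A; have [gC _ _] := set_valP C; have [gD _ _] := stD; have [gE _ _] := stE.
have [u uD] := collapses_to_retract CD gC D1.
pose d := retract u; pose e := column (val N).
have eE i : same_point (e i) (mark (val E) i) by rewrite EN; apply/same_pointP.
have d0 i : d i != 0 by exact: retract_neq0.
have e0 i : e i != 0 by have [_ _ _ _ [mark0 _]] := gE; have := mark0 i; rewrite EN.
have [B01 B2] : weight_domain B.
  by have [c _ Dc] := Domega_chamber; move: BD; rewrite Dc => /connected_component_sub[].
have B0 i : 0 <= B 0 i by have /andP[/ltW] := B01 i.
(* The blocks are the coincidence classes of marked points in [D] and in [E], each of weight at most
   1 by stability. *)
have [i [j [k]]] := common_transversal B0 B2 (stable_block_weight stD D1 uD)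
  (stable_block_weight stE E1 eE).
rewrite /= !inE !negb_or => /and3P[/andP[/andP[dij dik] /andP[djk _]] /andP[eij eik] /andP[ejk _]].
have distinct (x y : 'rV[R[i]]_2) : x != 0 -> y != 0 -> genmx x != genmx y -> det2 x y != 0.
  by move=> x0 y0; rewrite -same_pointE//; apply: contraNN => /genmxP ->.
have CR := cross_ratio_limit Phi_homeo Phi_main p_cont p_id Phiz pz.
have {}dij := distinct _ _ (d0 i) (d0 j) dij; have {}eij := distinct _ _ (e0 i) (e0 j) eij.
have {}dik := distinct _ _ (d0 i) (d0 k) dik; have {}eik := distinct _ _ (e0 i) (e0 k) eik.
have {}djk := distinct _ _ (d0 j) (d0 k) djk; have {}ejk := distinct _ _ (e0 j) (e0 k) ejk.
have CRl := cross_ratio_clear d0 e0 dij dik djk eij eik ejk (fun a b c l => CR u a b c l).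
have [g gU eg] := frame_projectivity dij dik djk eij eik ejk d0 e0 CRl.
rewrite Phiz pz rhoC PsiN; apply: Mbar_classP.
apply: (line_iso gE gD E1 D1 gU) => l; rewrite EN.
exact: same_point_trans (eg l) (uD l).
Qed.
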